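(* Fix the number $k\ge2$ of alternatives and let $K=\binom k2$. There exist constants $\alpha_k,\beta_k,\gamma_k>0$ depending only on $k$, and functions of $n$, denoted $o_k(1)$, which depend only on $k$ and $n$ (not on $d$ or $y$) and tend to $0$ as $n\to\infty$, such that for every odd $n$, every $d\ge1$ and every $y\in\{-1,1\}^K$, $$\Big|\Pr[Y=y\mid\mathcal E_d]-\frac1{2^K}\Big|\le\alpha_k\frac{d^2}{n}+o_k(1).$$ In particular, $$\Big|\Pr[Y\text{ is transitive}\mid\mathcal E_d]-\frac{k!}{2^K}\Big|\le\beta_k\frac{d^2}{n}+o_k(1)$$ and $$\Big|\Pr[Y\text{ has a Condorcet winner}\mid\mathcal E_d]-\frac{k}{2^{k-1}}\Big|\le\gamma_k\frac{d^2}{n}+o_k(1).$$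
   Context: Model: each of $n$ voters ($n$ odd) independently chooses one of the $k!$ rankings (linear orders) of $k$ alternatives uniformly at random. Fix an enumeration of the $K=\binom k2$ unordered pairs of alternatives, with a fixed order $(a,b)$ inside each pair. For each such pair, $S^{(ab)}$ is the number of voters who prefer $a$ to $b$ minus the number of voters who prefer $b$ to $a$, and $Y^{(ab)}=\mathrm{sgn}(S^{(ab)})\in\{-1,1\}$. $Y\in\{-1,1\}^K$ is the tuple of all $Y^{(ab)}$; it encodes a tournament on the alternatives in which $a$ beats $b$ iff $Y^{(ab)}=1$. $Y$ is transitive if this tournament is a linear order; it has a Condorcet winner if some alternative beats all others. For $d\ge1$, $\mathcal E_d$ is the event that $|S^{(ab)}|\le d$ for every pair $\{a,b\}$. *)

(* Defs.v *)
From mathcomp Require Import all_boot all_order all_algebra all_fingroup.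

Set Implicit Arguments.
Unset Strict Implicit.
Unset Printing Implicit Defensive.

Import Order.TTheory GRing.Theory Num.Theory.
Local Open Scope ring_scope.

(* A ranking of the alternatives 'I_k is the permutation that sends each
   alternative to its position, position 0 being the top one. *)
Definition ranking (k : nat) := {perm 'I_k}.

Definition prefers (k : nat) (s : ranking k) (a b : 'I_k) : bool :=
  (s a < s b)%N.

Definition profile (n k : nat) := {ffun 'I_n -> ranking k}.

Definition margin (n k : nat) (w : profile n k) (a b : 'I_k) : int :=
  #|[set v | prefers (w v) a b]|%:Z - #|[set v | prefers (w v) b a]|%:Z.

(* e lists every unordered pair of distinct alternatives exactly once, with a
   chosen order inside each pair. *)
Definition pair_enumeration (k : nat) (e : 'I_'C(k, 2) -> 'I_k * 'I_k) : Prop :=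
  (forall i, (e i).1 != (e i).2) /\
  (forall a b, a != b -> exists! i, [set (e i).1; (e i).2] = [set a; b]).

Definition is_sign_vector (K : nat) (y : {ffun 'I_K -> int}) : Prop :=
  forall i, y i = -1 \/ y i = 1.

Definition outcome (n k : nat) (e : 'I_'C(k, 2) -> 'I_k * 'I_k)
    (w : profile n k) : {ffun 'I_'C(k, 2) -> int} :=
  [ffun i => Num.sg (margin w (e i).1 (e i).2)].

Definition beats (k : nat) (e : 'I_'C(k, 2) -> 'I_k * 'I_k)
    (y : {ffun 'I_'C(k, 2) -> int}) : rel 'I_k :=
  fun a b => [exists i, (e i == (a, b)) && (y i == 1)
                     || (e i == (b, a)) && (y i == -1)].

Definition strict_linear_order (T : finType) (r : rel T) : bool :=
  [&& [forall a, ~~ r a a],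
      [forall a, forall b, forall c, r a b && r b c ==> r a c]
    & [forall a, forall b, (a != b) ==> r a b || r b a]].

Definition is_transitive (k : nat) (e : 'I_'C(k, 2) -> 'I_k * 'I_k)
    (y : {ffun 'I_'C(k, 2) -> int}) : bool :=
  strict_linear_order (beats e y).

Definition has_condorcet_winner (k : nat) (e : 'I_'C(k, 2) -> 'I_k * 'I_k)
    (y : {ffun 'I_'C(k, 2) -> int}) : bool :=
  [exists a, forall b, (b != a) ==> beats e y a b].

Definition close_election (R : realFieldType) (n k : nat) (d : R) :
    {set profile n k} :=
  [set w | [forall a, forall b,
     (a != b) ==> (`|margin w a b|%:~R <= d)]].

(* Product over the voters of the uniform distribution on rankings. *)
Definition Pr (R : realFieldType) (n k : nat) (A : {set profile n k}) : R :=
  \sum_(w in A) \prod_(v < n) #|{: ranking k}|%:R^-1.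

(* Junk value 0 when Pr B = 0; for B = close_election n k d with n odd and
   1 <= d this does not occur (one ranking, plus pairs of opposite rankings,
   gives all margins 1 or -1). *)
Definition condPr (R : realFieldType) (n k : nat) (A B : {set profile n k}) : R :=
  Pr R (A :&: B) / Pr R B.

(* Main.v *)
(** The o(1) terms can be taken to be 0, and no Fourier analysis is needed.

    For each pair count the voters who prefer its first element. The vector of
    counts is the endpoint of a random walk of n steps in {0,1}^K, viewed on the
    torus (Z/(n+1))^K, where it does not wrap around. Let p_m be the law of the
    m-step walk. Two rankings that differ by exchanging their top two
    alternatives give steps that differ by a unit vector, so the squared L2 norm
    of a unit difference of p_m is at most a constant times the decrease of
    |p_m|^2 in one step. Both quantities decrease in m; telescoping bounds the
    former by O(|p_(m/2)|^2 / m), and a Nash-type inequality for boxes of side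
    about sqrt m then gives |p_m|^2 = O(m^(-K/2)). Chebyshev and Cauchy-Schwarz
    give the matching lower bound.

    Reversing all rankings gives p_n the symmetry x -> (n,...,n) - x, which turns
    p_n(x) - p_n(x') into half a mixed second difference of p_n = p_m * p_(m+1).
    Hence it is O(d^2/n) n^(-K/2) for x, x' within distance d of the centre,
    while p_n is at least a constant times n^(-K/2) near the centre. Reflecting
    coordinates exchanges the sign patterns, so they are all equally likely up to
    a relative error O(d^2/n) (when d^2/n is not small there is nothing to
    prove). The last two claims follow by counting sign patterns. *)

Require Import Defs.
From mathcomp Require Import all_boot all_order all_algebra all_fingroup.
From mathcomp Require Import ring lra zify.

Set Implicit Arguments.
Unset Strict Implicit.
Unset Printing Implicit Defensive.

Import Order.TTheory GRing.Theory Num.Theory.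
Local Open Scope ring_scope.

(** * Squared L2 norm and oscillation of functions on a finite abelian group *)

Section L2.

Variables (R : realFieldType) (V : finZmodType).
Implicit Types (f : V -> R) (x y h g : V).

Definition sqn f : R := \sum_x f x ^+ 2.

Definition osc f h : R := \sum_x (f (x + h) - f x) ^+ 2.

Lemma sum_translate f h : \sum_x f (x + h) = \sum_x f x.
Proof. by rewrite [RHS](reindex_inj (addIr h)). Qed.

Lemma sum_reflect f h : \sum_x f (h - x) = \sum_x f x.
Proof. by rewrite [RHS](reindex_inj (can_inj (subKr h))). Qed.

Lemma sqn_ge0 f : 0 <= sqn f.
Proof. by apply: sumr_ge0 => x _; exact: sqr_ge0. Qed.

Lemma osc_ge0 f h : 0 <= osc f h.
Proof. by apply: sumr_ge0 => x _; exact: sqr_ge0. Qed.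

Lemma osc0 f : osc f 0 = 0.
Proof. by apply: big1 => x _; rewrite addr0 subrr expr0n. Qed.

Lemma oscN f h : osc f (- h) = osc f h.
Proof.
rewrite /osc -(sum_translate _ h); apply: eq_bigr => x _.
by rewrite addrK -sqrrN opprB.
Qed.

(** The square root of [osc f] is subadditive in the shift (Minkowski); squares with integer factors
    avoid roots. The weights [1 + t / s] and [1 + s / t] need nonzero factors, so [a = 0] and
    [b = 0], where [f] is invariant under one of the shifts, are treated apart. *)
Lemma oscD f h g (a b : nat) (E : R) :
  osc f h <= a%:R ^+ 2 * E -> osc f g <= b%:R ^+ 2 * E ->
  osc f (h + g) <= (a + b)%:R ^+ 2 * E.
Proof.
case: a => [|a] Hh.
  have oh0 x : f (x + h) - f x = 0.
    apply/eqP; rewrite -sqrf_eq0; apply/eqP.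
    have /psumr_eq0P -> // : osc f h = 0.
      by apply/eqP; rewrite eq_le osc_ge0 andbT; rewrite expr0n mul0r in Hh.
    by move=> y _; exact: sqr_ge0.
  rewrite add0n; apply: le_trans; rewrite /osc le_eqVlt; apply/orP; left.
  apply/eqP; apply: eq_bigr => x _; congr (_ ^+ 2).
  by rewrite [h + g]addrC addrA; move: (oh0 (x + g)) => /eqP; rewrite subr_eq0 => /eqP ->.
case: b => [|b] Hg.
  have og0 x : f (x + g) - f x = 0.
    apply/eqP; rewrite -sqrf_eq0; apply/eqP.
    have /psumr_eq0P -> // : osc f g = 0.
      by apply/eqP; rewrite eq_le osc_ge0 andbT; rewrite expr0n mul0r in Hg.
    by move=> y _; exact: sqr_ge0.
  rewrite addn0; apply: le_trans Hh; rewrite /osc le_eqVlt; apply/orP; left.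
  apply/eqP; apply: eq_bigr => x _; congr (_ ^+ 2).
  by rewrite addrA; move: (og0 (x + h)) => /eqP; rewrite subr_eq0 => /eqP ->.
rewrite natrD; move: (ltr0Sn R a) (ltr0Sn R b) Hh Hg.
move: (a.+1%:R : R) (b.+1%:R : R) => s t s0 t0 Hh Hg.
have key (u v : R) : (u + v) ^+ 2 <= (1 + t / s) * u ^+ 2 + (1 + s / t) * v ^+ 2.
  rewrite -subr_ge0.
  have -> : (1 + t / s) * u ^+ 2 + (1 + s / t) * v ^+ 2 - (u + v) ^+ 2
          = (t * u - s * v) ^+ 2 / (s * t).
    by field; rewrite !gt_eqF.
  by rewrite divr_ge0 ?sqr_ge0 // mulr_ge0 ?ltW.
have -> : (s + t) ^+ 2 * E
    = (1 + t / s) * (s ^+ 2 * E) + (1 + s / t) * (t ^+ 2 * E).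
  by field; rewrite !gt_eqF.
have c1 : 0 <= 1 + t / s by rewrite addr_ge0 // divr_ge0 ?ltW.
have c2 : 0 <= 1 + s / t by rewrite addr_ge0 // divr_ge0 ?ltW.
apply: le_trans (lerD (ler_wpM2l c1 Hh) (ler_wpM2l c2 Hg)).
rewrite {2}/osc -[\sum_x (f (x + h) - f x) ^+ 2](sum_translate _ g).
rewrite !mulr_sumr -big_split /=; apply: ler_sum => x _.
apply: le_trans (key _ _).
by rewrite [h + g]addrC addrA [f _ - f _ + _]addrA subrK.
Qed.

(* Pair f with its average over the translates by J: that average is at most
   1/|J| pointwise, while <f, f - f(. + j)> = osc f j / 2. *)
Lemma nash_box f (J : {set V}) (B : R) :
  (forall x, 0 <= f x) -> \sum_x f x = 1 -> J != set0 ->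
  {in J, forall j, osc f j <= B} -> sqn f <= #|J|%:R^-1 + B / 2.
Proof.
move=> f0 f1 J0 HB.
have cJ : 0 < #|J|%:R :> R by rewrite ltr0n card_gt0.
have pol j : sqn f = (\sum_x f x * f (x + j)) + osc f j / 2.
  have -> : osc f j = sqn f + sqn f - 2 * \sum_x f x * f (x + j).
    rewrite {1}/sqn -(sum_translate _ j) /osc /sqn mulr_sumr -sumrN -!big_split /=.
    by apply: eq_bigr => x _; ring.
  by field.
suff : #|J|%:R * sqn f <= 1 + #|J|%:R * (B / 2).
  move=> H; rewrite -(ler_pM2l cJ); apply: le_trans H _.
  by rewrite mulrDr mulfV ?gt_eqF.
rewrite !mulr_natl -!sumr_const.
rewrite (eq_bigr (fun j => (\sum_x f x * f (x + j)) + osc f j / 2)); last first.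
  by move=> j _; exact: pol.
rewrite big_split /=; apply: lerD; last first.
  by apply: ler_sum => j jJ; rewrite ler_pM2r ?invr_gt0 ?HB.
rewrite exchange_big /= -[leRHS]f1; apply: ler_sum => x _.
rewrite -mulr_sumr ler_piMr // -f1 -(sum_translate _ x).
under [leRHS]eq_bigr do rewrite addrC.
by rewrite big_mkcond /=; apply: ler_sum => y _; case: ifP.
Qed.

End L2.

(** * Random walks on a finite abelian group: dissipation and symmetry *)

Section Walk.

Variables (R : realFieldType) (V : finZmodType) (T : finType) (X : T -> V).
Hypothesis T_gt0 : (0 < #|T|)%N.
Implicit Types (f : V -> R) (x y h : V).

Local Notation M := (#|T|%:R : R).

Definition step f x : R := M^-1 * \sum_t f (x - X t).

Definition law (m : nat) : V -> R := iter m step (fun x => (x == 0)%:R).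

Let M_gt0 : 0 < M. Proof. by rewrite ltr0n. Qed.
Let M_neq0 : M != 0. Proof. by rewrite gt_eqF. Qed.

(** Variance is half the mean squared difference of two independent copies. *)
Lemma mean_variance (a : T -> R) :
  (M^-1 * \sum_t a t) ^+ 2 + (2 * M ^+ 2)^-1 * (\sum_s \sum_t (a s - a t) ^+ 2)
  = M^-1 * \sum_t a t ^+ 2.
Proof.
have -> : \sum_s \sum_t (a s - a t) ^+ 2
    = 2 * M * (\sum_t a t ^+ 2) - 2 * (\sum_t a t) ^+ 2.
  transitivity (\sum_s (M * a s ^+ 2 + \sum_t a t ^+ 2 - 2 * a s * \sum_t a t)).
    apply: eq_bigr => s _; rewrite mulr_sumr mulr_natl -sumr_const -sumrN -!big_split /=.
    by apply: eq_bigr => t _; ring.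
  rewrite sumrB big_split /= -mulr_sumr sumr_const -mulr_suml -mulr_sumr.
  rewrite -[_ *+ _]mulr_natl.
  by ring.
by field.
Qed.

(** [mean_variance] at each point: averaging dissipates exactly half the mean oscillation along
    differences of steps. *)
Lemma sqn_step f :
  sqn f = sqn (step f)
        + (2 * M ^+ 2)^-1 * (\sum_s \sum_t osc f (X t - X s)).
Proof.
have -> : \sum_s \sum_t osc f (X t - X s)
    = \sum_x \sum_s \sum_t (f (x - X s) - f (x - X t)) ^+ 2.
  rewrite [RHS]exchange_big /=; apply: eq_bigr => s _.
  rewrite [RHS]exchange_big /=; apply: eq_bigr => t _.
  rewrite /osc -(sum_translate _ (- X t)); apply: eq_bigr => x _.
  by rewrite addrA subrK.
rewrite /sqn mulr_sumr -big_split /=.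
rewrite (eq_bigr _ (fun x _ => mean_variance (fun t => f (x - X t)))).
rewrite -mulr_sumr exchange_big /=.
under [in RHS]eq_bigr do rewrite (sum_translate (fun x => f x ^+ 2)).
by rewrite sumr_const -[(\sum_x _) *+ _]mulr_natl mulrA mulVf ?mul1r.
Qed.

Lemma sqn_step_le f : sqn (step f) <= sqn f.
Proof.
rewrite [leRHS]sqn_step lerDl mulr_ge0 ?invr_ge0 ?mulr_ge0 ?sqr_ge0 //.
by do 2! [apply: sumr_ge0 => ? _]; exact: osc_ge0.
Qed.

(** Differencing commutes with [step], which contracts the L2 norm. *)
Lemma osc_step_le f h : osc (step f) h <= osc f h.
Proof.
have -> : osc (step f) h = sqn (step (fun x => f (x + h) - f x)).
  apply: eq_bigr => x _; congr (_ ^+ 2); rewrite /step -mulrBr -sumrB.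
  by congr (_ * _); apply: eq_bigr => t _; rewrite addrAC.
exact: sqn_step_le.
Qed.

(** For [s] and [t] distinct, the double sum of [sqn_step] contains this oscillation twice, at
    [(s, t)] and at [(t, s)], which cancels the factor 2. *)
Lemma osc_le_drop f s t :
  osc f (X t - X s) <= M ^+ 2 * (sqn f - sqn (step f)).
Proof.
have [->|nst] := eqVneq s t.
  by rewrite subrr osc0 mulr_ge0 ?sqr_ge0 // subr_ge0 sqn_step_le.
rewrite [sqn f]sqn_step [_ + _ - _]addrC addKr.
rewrite mulrA.
have -> : M ^+ 2 * (2 * M ^+ 2)^-1 = 2^-1 by field.
rewrite ler_pdivlMl // mulr_natl mulr2n.
have row_ge0 (P Q : pred T) : 0 <= \sum_(i | P i) \sum_(j | Q j) osc f (X j - X i).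
  by do 2! [apply: sumr_ge0 => ? _]; exact: osc_ge0.
rewrite (bigD1 s) //=; apply: lerD.
  by rewrite (bigD1 t) //= lerDl; apply: sumr_ge0 => ? _; exact: osc_ge0.
rewrite (bigD1 t) 1?eq_sym //= -[leLHS]addr0; apply: lerD => //.
rewrite (bigD1 s) //= -(opprB (X t)) oscN lerDl.
by apply: sumr_ge0 => ? _; exact: osc_ge0.
Qed.

(** Telescoping: oscillations never increase, so each of the [j] steps costs at least the final
    oscillation over [M ^+ 2], out of a budget [sqn (law i)]. *)
Lemma osc_law_drop i j s t :
  j%:R * osc (law (i + j)) (X t - X s) <= M ^+ 2 * sqn (law i).
Proof.
suff H : j%:R * osc (law (i + j)) (X t - X s)
    <= M ^+ 2 * (sqn (law i) - sqn (law (i + j))).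
  apply: le_trans H _; rewrite ler_pM2l ?exprn_gt0 // gerBl; exact: sqn_ge0.
elim: j => [|j IH]; first by rewrite mul0r addn0 subrr mulr0.
rewrite addnS [law _.+1]/= -/(law (i + j)) -natr1 mulrDl mul1r.
set f := law (i + j) in IH *.
have -> : sqn (law i) - sqn (step f)
        = (sqn (law i) - sqn f) + (sqn f - sqn (step f)) by ring.
rewrite mulrDr; apply: lerD.
  by apply: le_trans IH; rewrite ler_wpM2l // osc_step_le.
by apply: le_trans (osc_le_drop _ _ _); exact: osc_step_le.
Qed.

Lemma osc_law_mono i j h : osc (law (i + j)) h <= osc (law i) h.
Proof.
elim: j => [|j IH]; first by rewrite addn0.
by rewrite addnS; apply: le_trans IH; exact: osc_step_le.
Qed.

Lemma sqn_law_mono i j : sqn (law (i + j)) <= sqn (law i).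
Proof.
elim: j => [|j IH]; first by rewrite addn0.
by rewrite addnS; apply: le_trans IH; exact: sqn_step_le.
Qed.

Lemma law_ge0 m x : 0 <= law m x.
Proof.
elim: m x => [|m IH] x /=; first by rewrite ler0n.
by rewrite /step mulr_ge0 ?invr_ge0 //; apply: sumr_ge0.
Qed.

Lemma sum_law m : \sum_x law m x = 1.
Proof.
elim: m => [|m IH] /=.
  by rewrite (bigD1 0) //= eqxx big1 ?addr0 // => x /negPf ->.
rewrite -mulr_sumr exchange_big /=.
under eq_bigr do rewrite (sum_translate (law m)) IH.
by rewrite sumr_const mulVf.
Qed.

Lemma sqn_law_le1 m : sqn (law m) <= 1.
Proof.
apply: le_trans (sqn_law_mono 0 m) _; rewrite /sqn (bigD1 0) //= eqxx.
by rewrite big1 => [|x /negPf ->]; rewrite ?expr0n //= expr1n addr0.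
Qed.

Lemma law_convolution i j x :
  law (i + j) x = \sum_y law i y * law j (x - y).
Proof.
elim: i x => [|i IH] x.
  rewrite add0n (bigD1 0) //= eqxx mul1r subr0.
  by rewrite big1 ?addr0 // => y /negPf ->; rewrite mul0r.
rewrite addSn [LHS]/= /step.
under [RHS]eq_bigr do rewrite /step -mulrA mulr_suml.
rewrite -mulr_sumr exchange_big /=; congr (_ * _); apply: eq_bigr => t _.
rewrite IH -[LHS](sum_translate _ (- X t)); apply: eq_bigr => y _.
by rewrite opprD opprK addrACA addNr addr0.
Qed.

Section Symmetric.

Variables (rev : T -> T) (c : V).
Hypotheses (revK : involutive rev) (X_rev : forall t, X (rev t) = c - X t).

(** Reversing all [m] steps sends an endpoint [x] to [c *+ m - x] and preserves the uniform measure
    on step sequences. *)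
Lemma law_sym m x : law m (c *+ m - x) = law m x.
Proof.
elim: m x => [|m IH] x /=; first by rewrite sub0r oppr_eq0.
rewrite /step; congr (_ * _); rewrite [RHS](reindex_inj (inv_inj revK)) /=.
apply: eq_bigr => t _; rewrite X_rev -[RHS]IH; congr (law m _).
by rewrite mulrSr !opprB [c - X t - x]addrAC !addrA.
Qed.

(* 2 (p(x) - p(x')) is, by the symmetry of p = law (i + j), the mixed second
   difference of p along x' - x and c *+ (i + j) - x - x'; moving one
   difference onto each convolution factor leaves an inner product. *)
Lemma law_smooth i j x x' (B : R) :
  osc (law i) (x' - x) <= B -> osc (law j) (c *+ (i + j) - x - x') <= B ->
  `|law (i + j) x - law (i + j) x'| <= B / 2.
Proof.
set h := x' - x; set g := c *+ (i + j) - x - x' => Hh Hg.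
have E : 2 * (law (i + j) x - law (i + j) x')
    = \sum_y (law i (y + h) - law i y) * (law j (x - y + g) - law j (x - y)).
  have conv u v : \sum_y law i (y + u) * law j (x - y + v) = law (i + j) (x + u + v).
    rewrite law_convolution -[RHS](sum_translate _ u).
    apply: eq_bigr => y _; congr (_ * law j _).
    by rewrite [x + u + v]addrAC opprD [- y - u]addrC addrA addrK addrAC.
  transitivity (\sum_y (law i (y + h) * law j (x - y + g) + law i (y + 0) * law j (x - y + 0)
     - law i (y + h) * law j (x - y + 0) - law i (y + 0) * law j (x - y + g))).
    rewrite !sumrB !big_split /= !conv !addr0.
    have -> : x + h = x' by rewrite /h addrC subrK.
    have -> : x' + g = c *+ (i + j) - x by rewrite /g addrC subrK.
    have -> : x + g = c *+ (i + j) - x' by rewrite /g addrC [_ - x - x']addrAC subrK.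
    by rewrite !law_sym; ring.
  by apply: eq_bigr => y _; rewrite !addr0; ring.
have Hg' : \sum_y (law j (x - y + g) - law j (x - y)) ^+ 2 <= B.
  by rewrite (sum_reflect (fun y => (law j (y + g) - law j y) ^+ 2)).
suff : `|2 * (law (i + j) x - law (i + j) x')| <= B.
  by rewrite normrM ger0_norm // => H; rewrite ler_pdivlMr // mulrC.
rewrite E; apply: le_trans (ler_norm_sum _ _ _) _.
have H2 (u v : R) : `|u * v| <= (u ^+ 2 + v ^+ 2) / 2.
  rewrite ler_norml; have := sqr_ge0 (u - v); have := sqr_ge0 (u + v).
  by rewrite !expr2; lra.
apply: le_trans (ler_sum _ (fun y _ => H2 _ _)) _.
rewrite -mulr_suml big_split /= ler_pdivrMr // [leRHS]mulr_natr mulr2n.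
exact: lerD.
Qed.

(** By symmetry the convolution at the centre is the inner product of [law m] with itself. *)
Lemma law_center m : law (m + m) (c *+ m) = sqn (law m).
Proof.
by rewrite law_convolution; apply: eq_bigr => y _; rewrite law_sym expr2.
Qed.

(** For an odd number of steps: reach the centre [c *+ m] in [m + m] steps, then take the step
    [X t], of weight [1 / M]. *)
Lemma law_near_center m t : sqn (law m) / M <= law (m + m).+1 (c *+ m + X t).
Proof.
rewrite [law _.+1 _]/= /step mulrC ler_pM2l ?invr_gt0 //.
rewrite -law_center (bigD1 t) //= addrK lerDl.
by apply: sumr_ge0 => s _; exact: law_ge0.
Qed.

End Symmetric.

End Walk.

(** * Sums over profiles, with the walk as their image law *)

Section ProfileSums.

Variables (T : finType).

Definition fcons m (t : T) (w : {ffun 'I_m -> T}) : {ffun 'I_m.+1 -> T} :=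
  [ffun i => if unlift ord0 i is Some j then w j else t].

Lemma fcons0 m t (w : {ffun 'I_m -> T}) : fcons t w ord0 = t.
Proof. by rewrite ffunE unlift_none. Qed.

Lemma fconsS m t (w : {ffun 'I_m -> T}) j : fcons t w (lift ord0 j) = w j.
Proof. by rewrite ffunE liftK. Qed.

Lemma sum_ffun_recl (A : nmodType) m (F : {ffun 'I_m.+1 -> T} -> A) :
  \sum_w F w = \sum_t \sum_w F (fcons t w).
Proof.
rewrite pair_big /=.
rewrite (reindex (fun p : T * {ffun 'I_m -> T} => fcons p.1 p.2)) //.
exists (fun w : {ffun 'I_m.+1 -> T} => (w ord0, [ffun j : 'I_m => w (lift ord0 j)]))
  => [[t w]|w] _ /=.
  by rewrite fcons0; congr (_, _); apply/ffunP => j; rewrite ffunE fconsS.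
by apply/ffunP => i; rewrite ffunE; case: unliftP => [j|] ->; rewrite ?ffunE.
Qed.

Lemma sum_fcons (A : nmodType) m (g : T -> A) t (w : {ffun 'I_m -> T}) :
  \sum_v g (fcons t w v) = g t + \sum_v g (w v).
Proof.
rewrite big_ord_recl fcons0; congr (_ + _).
by apply: eq_bigr => j _; rewrite fconsS.
Qed.

(** Identifies [law] with the distribution of the sum of [X] over a uniform profile; the first
    coordinate of the profile accounts for the outermost [step]. *)
Lemma law_expectation (R : realFieldType) (V : finZmodType) (X : T -> V) m
    (F : V -> R) :
  \sum_x law R X m x * F x
  = (#|T|%:R ^+ m)^-1 * \sum_(w : {ffun 'I_m -> T}) F (\sum_v X (w v)).
Proof.
elim: m F => [|m IH] F.
  rewrite expr0 invr1 mul1r (bigD1 0) //= eqxx mul1r big1 ?addr0 => [|x /negPf ->].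
    transitivity (\sum_(w : {ffun 'I_0 -> T}) F 0).
      by rewrite sumr_const card_ffun card_ord expn0.
    by apply: eq_bigr => w _; rewrite big_ord0.
  by rewrite mul0r.
transitivity (#|T|%:R^-1 * \sum_t \sum_x law R X m x * F (x + X t)).
  under eq_bigr do rewrite /= /step -mulrA mulr_suml.
  rewrite -mulr_sumr exchange_big /=; congr (_ * _); apply: eq_bigr => t _.
  rewrite -[LHS](sum_translate _ (X t)).
  by apply: eq_bigr => x _; rewrite addrK.
rewrite sum_ffun_recl exprS invfM -mulrA; congr (_ * _).
rewrite [RHS]mulr_sumr; apply: eq_bigr => t _.
rewrite (IH (fun x => F (x + X t))); congr (_ * _).
by apply: eq_bigr => w _; rewrite sum_fcons addrC.
Qed.

(** Independent centred signs: the cross terms vanish because [G] sums to zero. *)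
Lemma second_moment (R : realFieldType) m (G : T -> R) :
  \sum_t G t = 0 -> (forall t, G t ^+ 2 = 1) ->
  \sum_(w : {ffun 'I_m -> T}) (\sum_v G (w v)) ^+ 2 = m%:R * #|T|%:R ^+ m.
Proof.
move=> G0 G1; elim: m => [|m IH].
  by rewrite mul0r big1 // => w _; rewrite big_ord0 expr0n.
rewrite sum_ffun_recl.
transitivity (\sum_(t : T) (#|T|%:R ^+ m + m%:R * #|T|%:R ^+ m
    + 2 * G t * \sum_(w : {ffun 'I_m -> T}) \sum_v G (w v))).
  apply: eq_bigr => t _; rewrite -IH mulr_sumr -natrX.
  have -> : (#|T| ^ m)%:R = \sum_(w : {ffun 'I_m -> T}) (1 : R).
    by rewrite sumr_const card_ffun card_ord.
  rewrite -!big_split /=; apply: eq_bigr => w _.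
  by rewrite sum_fcons sqrrD G1; ring.
rewrite !big_split /= -!mulr_suml -mulr_sumr G0 mulr0 mul0r addr0.
by rewrite !sumr_const -[_ ^+ m *+ _]mulr_natr -[m%:R *+ _]mulr_natr -natr1 exprS; ring.
Qed.

End ProfileSums.

(** * The torus: coordinates modulo [q.+1], unit shifts and boxes *)

Section Torus.

Variables (R : realFieldType) (K q : nat).

Local Notation V := 'rV['I_q.+1]_K.

Lemma inZpD a b : inZp (a + b) = inZp a + inZp b :> 'I_q.+1.
Proof. by apply: val_inj; rewrite /= modnDm. Qed.

Lemma inZp_sum (I : Type) (r : seq I) (P : pred I) (F : I -> nat) :
  inZp (\sum_(i <- r | P i) F i) = \sum_(i <- r | P i) (inZp (F i) : 'I_q.+1).
Proof. by apply: (big_morph _ inZpD); apply: val_inj. Qed.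

Definition row_of_nat (u : 'I_K -> nat) : V := \row_i inZp (u i).

Lemma row_of_natD u1 u2 :
  row_of_nat (fun i => u1 i + u2 i)%N = row_of_nat u1 + row_of_nat u2.
Proof. by apply/rowP => i; rewrite !mxE inZpD. Qed.

Lemma row_of_nat_sum (I : Type) (r : seq I) (F : I -> 'I_K -> nat) :
  row_of_nat (fun i => \sum_(j <- r) F j i)%N = \sum_(j <- r) row_of_nat (F j).
Proof.
by apply/rowP => i; rewrite summxE mxE inZp_sum; apply: eq_bigr => j _; rewrite mxE.
Qed.

Lemma eq_row_of_nat u1 u2 : u1 =1 u2 -> row_of_nat u1 = row_of_nat u2.
Proof. by move=> eu; apply/rowP => i; rewrite !mxE eu. Qed.

Definition unit_row (i : 'I_K) : V := row_of_nat (fun j => j == i).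

Lemma osc_sum (f : V -> R) (E : R) (h : 'I_K -> V) (l : 'I_K -> nat) :
  (forall i, osc f (h i) <= (l i)%:R ^+ 2 * E) ->
  osc f (\sum_i h i) <= (\sum_i l i)%N%:R ^+ 2 * E.
Proof.
move=> H; apply: (big_rec2 (fun (u : V) a => osc f u <= a%:R ^+ 2 * E)) => [|i a u _ Hu].
  by rewrite osc0 expr0n mul0r.
exact: oscD.
Qed.

Lemma osc_mulrn (f : V -> R) (E : R) (h : V) (l : nat) :
  osc f h <= E -> osc f (h *+ l) <= l%:R ^+ 2 * E.
Proof.
move=> H; elim: l => [|l IH]; first by rewrite mulr0n osc0 expr0n mul0r.
by rewrite mulrSr -(addn1 l); apply: oscD => //; rewrite expr1n mul1r.
Qed.

Lemma unit_row_mulrn i l : unit_row i *+ l = \row_j if j == i then inZp l else 0.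
Proof.
elim: l => [|l IH].
  by apply/rowP => j; rewrite mulr0n !mxE; case: ifP => // _; apply: val_inj.
rewrite mulrSr IH; apply/rowP => j; rewrite !mxE -(addn1 l).
case: eqP => [_|_] /=; first by rewrite inZpD.
by rewrite add0r; apply: val_inj.
Qed.

(** Go from 0 to [h] along unit vectors: the sum of the [l i] counts the unit shifts, and their
    signs do not matter by [oscN]. *)
Lemma osc_row (f : V -> R) (E : R) (h : V) (l : 'I_K -> nat) :
  (forall i, osc f (unit_row i) <= E) ->
  (forall i, h 0 i = inZp (l i) \/ h 0 i = - inZp (l i)) ->
  osc f h <= (\sum_i l i)%N%:R ^+ 2 * E.
Proof.
move=> HE Hh.
pose g i : V := if h 0 i == inZp (l i) then unit_row i *+ l i else - (unit_row i *+ l i).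
have -> : h = \sum_i g i.
  apply/rowP => j; rewrite summxE (bigD1 j) //= big1 => [|i ij].
    rewrite addr0 /g; case: eqP => [->|nh].
      by rewrite unit_row_mulrn mxE eqxx.
    by rewrite mxE unit_row_mulrn mxE eqxx; case: (Hh j).
  by rewrite /g; case: ifP => _; rewrite ?mxE unit_row_mulrn !mxE eq_sym (negPf ij) ?oppr0.
apply: osc_sum => i; rewrite /g; case: ifP => _; rewrite ?oscN; exact: osc_mulrn.
Qed.

Definition box (a r : nat) : {set V} :=
  [set row_of_nat (fun i => a + j i)%N | j : {ffun 'I_K -> 'I_r}].

Lemma card_box_le a r : (#|box a r| <= r ^ K)%N.
Proof.
apply: leq_trans (leq_imset_card _ _) _.
by rewrite card_ffun !card_ord.
Qed.

(** A side of at most [q.+1] does not wrap around, so the parametrisation is injective. *)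
Lemma card_box0 r : (r <= q.+1)%N -> #|box 0 r| = (r ^ K)%N.
Proof.
move=> rq; rewrite card_imset ?card_ffun ?card_ord // => j1 j2 ej.
apply/ffunP => i; apply: val_inj.
have := congr1 (fun x : V => val (x 0 i)) ej; rewrite !mxE /= !modn_small //.
all: exact: leq_trans (ltn_ord _) rq.
Qed.

Lemma mem_box a r (u : 'I_K -> nat) :
  (forall i, a <= u i < a + r)%N -> row_of_nat u \in box a r.
Proof.
move=> H.
have Hr i : (u i - a < r)%N by have := H i; lia.
apply/imsetP; exists [ffun i => Ordinal (Hr i)] => //.
by apply: eq_row_of_nat => i; rewrite ffunE /=; have := H i; lia.
Qed.

End Torus.

(** * Walks with steps in {0,1}^K *)

(** Every unit vector is then a difference of two steps, the kind of shift that [osc_law_drop]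
    controls. *)
Definition adjacent_ballots (K : nat) (T : Type) (b : T -> 'I_K -> bool) : Prop :=
  forall i, exists s t, forall j, (b t j = b s j + (j == i) :> nat)%N.

Definition reversible_ballots (K : nat) (T : Type) (b : T -> 'I_K -> bool) : Prop :=
  exists2 rev : T -> T, involutive rev & forall t i, b (rev t) i = ~~ b t i.

Section BinaryBallots.

Variables (R : realFieldType) (K : nat) (T : finType) (b : T -> 'I_K -> bool).
Hypothesis T_gt0 : (0 < #|T|)%N.

Local Notation M := (#|T|%:R : R).

Let M_gt0 : 0 < M. Proof. by rewrite ltr0n. Qed.

Definition ballot (q : nat) (t : T) : 'rV['I_q.+1]_K :=
  row_of_nat q (fun i => b t i).

Lemma pow4E (t : nat) : (4 ^ t = (2 ^ t) ^ 2)%N.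
Proof. by rewrite -expnM mulnC expnM. Qed.

Section Smoothness.

Hypothesis b_adj : adjacent_ballots b.

Lemma unit_row_ballot q i : exists s t, unit_row q i = ballot q t - ballot q s.
Proof.
have [s [t st]] := b_adj i; exists s, t.
apply/eqP; rewrite eq_sym subr_eq addrC -row_of_natD; apply/eqP.
exact: eq_row_of_nat.
Qed.

Lemma osc_law_unit q i j (k : 'I_K) :
  j%:R * osc (law R (ballot q) (i + j)) (unit_row q k)
  <= M ^+ 2 * sqn (law R (ballot q) i).
Proof. by have [s [t ->]] := unit_row_ballot q k; exact: osc_law_drop. Qed.

End Smoothness.

Hypothesis b_rev : reversible_ballots b.

Lemma ballot_rev q : exists2 rev : T -> T, involutive rev &
  forall t, ballot q (rev t) = row_of_nat q (fun=> 1%N) - ballot q t.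
Proof.
have [rev revK H] := b_rev; exists rev => // t.
apply/eqP; rewrite eq_sym subr_eq -row_of_natD; apply/eqP.
by apply: eq_row_of_nat => i; rewrite H; case: (b t i).
Qed.

Lemma ballot_mean0 i : \sum_t ((-1) ^+ b t i : R) = 0.
Proof.
have [rev revK H] := b_rev.
have : \sum_t ((-1) ^+ b t i : R) = - \sum_t ((-1) ^+ b t i : R).
  rewrite {1}(reindex_inj (inv_inj revK)) /= -sumrN; apply: eq_bigr => t _.
  by rewrite H; case: (b t i); rewrite ?expr1 ?expr0 ?opprK.
by move=> e; lra.
Qed.

Definition votes (n : nat) (w : {ffun 'I_n -> T}) (i : 'I_K) : nat :=
  (\sum_v b (w v) i)%N.

Lemma votes_le n (w : {ffun 'I_n -> T}) i : (votes w i <= n)%N.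
Proof.
apply: (@leq_trans (\sum_(v < n) 1)%N); last by rewrite sum1_card card_ord.
by apply: leq_sum => v _; case: (b _ _).
Qed.

Lemma sum_ballot q n (w : {ffun 'I_n -> T}) :
  \sum_v ballot q (w v) = row_of_nat q (votes w).
Proof. by rewrite -row_of_nat_sum. Qed.

Lemma signed_votes n (w : {ffun 'I_n -> T}) i :
  \sum_v ((-1) ^+ b (w v) i : R) = n%:R - 2 * (votes w i)%:R.
Proof.
have -> : n%:R = \sum_(v < n) (1 : R) by rewrite sumr_const card_ord.
rewrite /votes natr_sum mulr_sumr -sumrB; apply: eq_bigr => v _.
by case: (b _ _); rewrite /= ?expr1 ?expr0; ring.
Qed.

(** Chebyshev: the second moments of the [K] signed sums add up to [K * m * M ^+ m], and each bad
    profile contributes at least [L ^ 2], so at most half of the profiles are bad. *)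
Lemma votes_concentration m L : (2 * K * m <= L ^ 2)%N -> (0 < L)%N ->
  M ^+ m <= 2 * #|[set w : {ffun 'I_m -> T} |
    [forall i, (2 * votes w i <= m + L) && (m <= 2 * votes w i + L)]%N]|%:R.
Proof.
move=> HL L0; set G := [set w | _].
have cG : \sum_(w in ~: G) (L%:R ^+ 2 : R)
    <= \sum_(w : {ffun 'I_m -> T}) \sum_i (\sum_v ((-1) ^+ b (w v) i : R)) ^+ 2.
  rewrite big_mkcond /=; apply: ler_sum => w _.
  case: ifP => [|_]; last by apply: sumr_ge0 => i _; exact: sqr_ge0.
  rewrite !inE negb_forall => /existsP[i Hi].
  rewrite (bigD1 i) //= -[leLHS]addr0; apply: lerD; last first.
    by apply: sumr_ge0 => j _; exact: sqr_ge0.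
  rewrite signed_votes -[leRHS]real_normK ?num_real // lerXn2r ?nnegrE //.
  have : (L%:Z <= `|m%:Z - 2 * (votes w i)%:Z|)%R by lia.
  by rewrite -(ler_int R) intr_norm rmorphB rmorphM.
rewrite exchange_big /= sumr_const in cG.
have G2 t i : ((-1) ^+ b t i : R) ^+ 2 = 1.
  by case: (b t i); rewrite ?expr0 ?expr1 ?sqrrN expr1n.
rewrite (eq_bigr _ (fun i _ => second_moment m (ballot_mean0 i) (G2^~ i))) in cG.
rewrite sumr_const card_ord -[(_ ^+ 2) *+ _]mulr_natl -[_ *+ K]mulr_natl in cG.
have cT : #|G|%:R + #|~: G|%:R = M ^+ m :> R.
  by rewrite -natrD cardsC card_ffun card_ord natrX.
have L0' : 0 < L%:R ^+ 2 :> R by rewrite exprn_gt0 // ltr0n.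
have HLR : 2 * (K%:R * m%:R) <= L%:R ^+ 2 :> R.
  by rewrite -natrX -!natrM ler_nat mulnA.
suff : 2 * #|~: G|%:R <= M ^+ m by rewrite -cT; lra.
rewrite -(ler_pM2r L0').
apply: (@le_trans _ _ (2 * (K%:R * m%:R) * M ^+ m)).
  by rewrite -[leLHS]mulrA -[leRHS]mulrA ler_pM2l // -[leRHS]mulrA.
by rewrite [leLHS]mulrC ler_pM2l // exprn_gt0.
Qed.

(* Cauchy-Schwarz on a box carrying half of the mass. *)
Lemma sqn_law_lower q m L : (2 * K * m <= L ^ 2)%N -> (0 < L)%N ->
  (4 * (L + 2)%:R ^+ K)^-1 <= sqn (law R (ballot q) m).
Proof.
move=> HL L0; set p := law _ _ _.
(* Side [L + 2] leaves room for the rounding in [(m - L)./2]. *)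
pose J := box K q (m - L)./2 (L + 2).
have HJ : 1 <= 2 * \sum_(x in J) p x.
  have -> : \sum_(x in J) p x = \sum_x p x * (x \in J)%:R.
    by rewrite big_mkcond /=; apply: eq_bigr => x _; case: (x \in J); rewrite ?mulr1 ?mulr0.
  rewrite law_expectation mulrCA ler_pdivlMl ?exprn_gt0 // mulr1.
  apply: le_trans (votes_concentration HL L0) _; rewrite ler_pM2l //.
  rewrite -sum1_card natr_sum big_mkcond /=; apply: ler_sum => w _.
  case: ifP => [|_]; last by rewrite ler0n.
  rewrite inE => /forallP H; rewrite sum_ballot mem_box ?lexx // => i.
  have := H i; lia.
have cJ : #|J|%:R <= (L + 2)%:R ^+ K :> R.
  by rewrite -natrX ler_nat card_box_le.
have N0 : 0 < (L + 2)%:R ^+ K :> R by rewrite exprn_gt0 // ltr0n; lia.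
move: ((L + 2)%:R ^+ K : R) cJ N0 => N cJ N0.
(* Cauchy-Schwarz as a tangent line: [p x ^+ 2 >= 2 * s * p x - s ^+ 2], where [s] is the density of
   mass one half spread over [N] points. *)
pose s : R := (2 * N)^-1.
have s0 : 0 < s by rewrite invr_gt0 mulr_gt0.
apply: (@le_trans _ _ (\sum_(x in J) (2 * s * p x - s ^+ 2))); last first.
  rewrite /sqn [leRHS](bigID (mem J)) /= -[leLHS]addr0; apply: lerD.
    apply: ler_sum => x _; rewrite -subr_ge0.
    by rewrite [leRHS](_ : _ = (p x - s) ^+ 2) ?sqr_ge0 //; ring.
  by apply: sumr_ge0 => x _; exact: sqr_ge0.
rewrite sumrB -mulr_sumr sumr_const -[_ ^+ 2 *+ _]mulr_natl.
set S := \sum_(x in J) _ in HJ *.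
apply: (@le_trans _ _ (s * 1 - N * s ^+ 2)).
  by rewrite le_eqVlt; apply/orP; left; apply/eqP; rewrite /s; field; rewrite gt_eqF.
apply: lerB; last by rewrite ler_wpM2r ?sqr_ge0.
by rewrite -mulrA mulrCA ler_pM2l.
Qed.

End BinaryBallots.

(* With a_t = |p_(4^t)|^2, applying nash_box to the box of side 2^(t-s) gives
   a_(t+1) <= 2^(-(t-s)K) + a_t / (2 * 2^K); s absorbs the constants. *)
Lemma sqn_law_upper (R : realFieldType) (K : nat) (T : finType) :
  (0 < #|T|)%N -> exists2 C : R, 0 < C &
  forall (b : T -> 'I_K -> bool), adjacent_ballots b ->
  forall q t, (4 ^ t <= q.+1)%N ->
  sqn (law R (ballot b q) (4 ^ t)%N) <= C * (2 ^+ (t * K))^-1.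
Proof.
move=> T_gt0; pose M : R := #|T|%:R; have M_gt0 : 0 < M by rewrite ltr0n.
(* Chosen so that [K ^ 2 * #|T| ^ 2 * 2 ^ K <= 4 ^ s], which follows from [x < 4 ^ x]. *)
pose s := (K ^ 2 * #|T| ^ 2 * 2 ^ K)%N.
(* With this [C] the trivial bound 1 suffices while [t < s]; later the box term and the inductive
   term are each at most half of the bound. *)
pose C : R := 2 ^+ (s.+1 * K).+1.
have C0 : 0 < C by rewrite exprn_gt0.
exists C => // b b_adj q; elim=> [_|t IH tq].
  rewrite mul0n expr0 invr1 mulr1; apply: le_trans (sqn_law_le1 _ _ T_gt0 _) _.
  by rewrite exprn_ege1 // ler1n.
have pw (j : nat) : 0 < 2 ^+ j :> R by rewrite exprn_gt0.
have [ts|st] := ltnP t s.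
  apply: le_trans (sqn_law_le1 _ _ T_gt0 _) _.
  rewrite ler_pdivlMr // mul1r /C ler_eXn2l ?ltr1n //.
  by apply: leqW; rewrite leq_mul2r ltnS (ltnW ts) orbT.
have {}IH := IH (leq_trans (leq_pexp2l (isT : 0 < 4)%N (leqnSn t)) tq).
set a := sqn _ in IH.
pose r := (2 ^ (t - s))%N.
have r_gt0 : (0 < r)%N by rewrite expn_gt0.
have rq : (r <= q.+1)%N.
  apply: leq_trans tq; apply: (@leq_trans (2 ^ t.+1)).
    by rewrite leq_exp2l //; lia.
  by rewrite leq_exp2r.
pose E : R := M ^+ 2 * a / (3 * 4 ^+ t).
have HE k : osc (law R (ballot b q) (4 ^ t.+1)) (unit_row q k) <= E.
  rewrite ler_pdivlMr ?mulr_gt0 ?exprn_gt0 // mulrC.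
  (* The last [3 * 4 ^ t] steps smooth the law; the first [4 ^ t] supply the norm [a]. *)
  have -> : (4 ^ t.+1 = 4 ^ t + 3 * 4 ^ t)%N by rewrite expnS; lia.
  by have := osc_law_unit R T_gt0 b_adj q (4 ^ t) (3 * 4 ^ t) k; rewrite natrM natrX.
have a0 : 0 <= a by exact: sqn_ge0.
have E0 : 0 <= E by rewrite divr_ge0 ?mulr_ge0 ?sqr_ge0 ?exprn_ge0.
have := @nash_box R _ (law R (ballot b q) (4 ^ t.+1)) (box K q 0 r)
  ((K * r)%:R ^+ 2 * E) (law_ge0 _ _ _) (sum_law _ _ T_gt0 _).
rewrite card_box0 // -card_gt0 card_box0 // expn_gt0 r_gt0 => /(_ isT) H.
apply: le_trans (H _) _ => {H}.
  move=> h /imsetP[j _ ->].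
  apply: le_trans (osc_row (l := fun i => j i) HE _) _.
    by move=> i; left; rewrite mxE.
  rewrite ler_wpM2r // lerXn2r ?nnegrE // ler_nat.
  apply: (@leq_trans (\sum_(i < K) r)); last by rewrite sum_nat_const card_ord.
  by apply: leq_sum => i _; exact: ltnW.
have sK : (K ^ 2 * #|T| ^ 2 * 2 ^ K <= 4 ^ s)%N.
  by apply: ltnW; exact: (ltn_expl _ (isT : 1 < 4)%N).
have e4 : 4 ^+ t = r%:R ^+ 2 * 4 ^+ s :> R.
  by rewrite -!natrX -natrM; congr (_%:R); rewrite !pow4E -expnMn -expnD subnK.
have sKR : K%:R ^+ 2 * M ^+ 2 * 2 ^+ K <= 4 ^+ s :> R.
  by rewrite -!natrX -!natrM ler_nat.
have r0 : 0 < r%:R :> R by rewrite ltr0n.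
have -> : (K * r)%:R ^+ 2 * E / 2 = K%:R ^+ 2 * M ^+ 2 / (6 * 4 ^+ s) * a.
  rewrite /E e4 natrM; have : 0 < 4 ^+ s :> R by rewrite exprn_gt0.
  move: (4 ^+ s : R) (r%:R : R) r0 => u v v0 u0.
  by field; rewrite !gt_eqF.
have Hc : K%:R ^+ 2 * M ^+ 2 / (6 * 4 ^+ s) <= (2 * 2 ^+ K)^-1 :> R.
  have s4 : 0 < 4 ^+ s :> R by rewrite exprn_gt0.
  rewrite ler_pdivrMr ?mulr_gt0 // ler_pdivlMl ?mulr_gt0 //.
  rewrite [leLHS](_ : _ = 2 * (K%:R ^+ 2 * M ^+ 2 * 2 ^+ K)); last by ring.
  by lra.
apply: le_trans (lerD (lexx _) (ler_pM _ _ Hc IH)) _ => //.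
  by rewrite divr_ge0 ?mulr_ge0 ?sqr_ge0 ?exprn_ge0.
have -> : (r ^ K)%N%:R^-1 = 2 ^+ (s * K) * (2 ^+ (t * K))^-1 :> R.
  rewrite -expnM natrX; apply: (mulIf (lt0r_neq0 (pw (t * K)%N))).
  rewrite mulfVK ?lt0r_neq0 //; apply: (mulfI (lt0r_neq0 (pw ((t - s) * K)%N))).
  by rewrite mulrA mulfV ?lt0r_neq0 // mul1r -exprD -mulnDl subnK.
rewrite mulSn exprD invfM /C mulSn exprS exprD.
rewrite le_eqVlt; apply/orP; left; apply/eqP.
by field; rewrite !gt_eqF ?pw.
Qed.

(** * Near-uniformity of the law around its centre *)

Section NearUniform.

Variables (R : realFieldType) (K : nat) (T : finType).
Hypothesis T_gt0 : (0 < #|T|)%N.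

Local Notation M := (#|T|%:R : R).

Let M_gt0 : 0 < M. Proof. by rewrite ltr0n. Qed.

(** Doubled, because the centre [n / 2] is a half-integer for odd [n]. *)
Definition central (n l : nat) (x : 'rV['I_n.+1]_K) : bool :=
  [forall i, (2 * x 0%R i <= n + l) && (n <= 2 * x 0%R i + l)]%N.

Lemma inZpB q u v : (v <= u)%N -> inZp u - inZp v = inZp (u - v)%N :> 'I_q.+1.
Proof. by move=> vu; apply/eqP; rewrite subr_eq -inZpD subnK. Qed.

Lemma row_of_nat1_mulrn q j :
  row_of_nat q (fun=> 1%N) *+ j = row_of_nat q (fun=> j) :> 'rV_K.
Proof.
elim: j => [|j IH]; first by apply/rowP => k; rewrite mulr0n !mxE; apply: val_inj.
by rewrite mulrSr IH -row_of_natD; apply: eq_row_of_nat => k; rewrite addn1.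
Qed.

(** Both shifts have coordinates of absolute value at most [l]: central points lie within [l / 2] of
    the centre, and the second shift leads from [x'] to the reflection of [x]. *)
Lemma osc_central n l (f : 'rV['I_n.+1]_K -> R) E x x' :
  0 <= E -> (forall i, osc f (unit_row n i) <= E) -> central l x -> central l x' ->
  osc f (x' - x) <= (K * l)%:R ^+ 2 * E
  /\ osc f (row_of_nat n (fun=> 1%N) *+ n - x - x') <= (K * l)%:R ^+ 2 * E.
Proof.
move=> E0 HE /forallP cx /forallP cx'.
have sum_le (d : 'I_K -> nat) : (forall i, d i <= l)%N ->
    (\sum_i d i)%N%:R ^+ 2 * E <= (K * l)%:R ^+ 2 * E.
  move=> dl; rewrite ler_wpM2r // lerXn2r ?nnegrE // ler_nat.
  apply: (@leq_trans (\sum_(i < K) l)); last by rewrite sum_nat_const card_ord.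
  exact: leq_sum.
pose u i : nat := x 0 i; pose u' i : nat := x' 0 i.
have {}cx i : (2 * u i <= n + l)%N && (n <= 2 * u i + l)%N by exact: cx.
have {}cx' i : (2 * u' i <= n + l)%N && (n <= 2 * u' i + l)%N by exact: cx'.
have xE i : x 0 i = inZp (u i) by rewrite valZpK.
have x'E i : x' 0 i = inZp (u' i) by rewrite valZpK.
move: u u' cx cx' xE x'E => u u' cx cx' xE x'E.
split.
  (* The sum of the two truncated subtractions is the distance between [u i] and [u' i]. *)
  apply: le_trans (osc_row (l := fun i => ((u' i - u i) + (u i - u' i))%N) HE _) _.
    move=> i; rewrite !mxE xE x'E; have [le|/ltnW le] := leqP (u i) (u' i).
      by left; rewrite inZpB //; congr (inZp _); lia.
    by right; rewrite -opprB inZpB //; congr (- inZp _); lia.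
  by apply: sum_le => i; have := cx i; have := cx' i; lia.
apply: le_trans (osc_row (l := fun i => ((n - (u i + u' i)) + (u i + u' i - n))%N) HE _) _.
  move=> i; have -> : (row_of_nat n (fun=> 1%N) *+ n - x - x') 0 i
      = inZp n - inZp (u i + u' i)%N :> 'I_n.+1.
    rewrite row_of_nat1_mulrn.
    by rewrite !mxE xE x'E inZpD opprD addrA.
  have [le|/ltnW le] := leqP (u i + u' i)%N n.
    by left; rewrite inZpB //; congr (inZp _); lia.
  by right; rewrite -opprB inZpB //; congr (- inZp _); lia.
by apply: sum_le => i; have := cx i; have := cx' i; lia.
Qed.

(** Up to constants [rho] is the scale [n ^ (-K/2)]; with both bounds stated in units of [rho], it
    cancels in ratios. *)
Lemma law_near_uniform : exists C c : R, [/\ 0 <= C, 0 < c &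
  forall b : T -> 'I_K -> bool, adjacent_ballots b -> reversible_ballots b ->
  forall m n, (4 <= m)%N -> n = (m + m).+1 -> exists2 rho : R, 0 < rho &
    let p := law R (ballot b n) n in
    (forall l x x', central l x -> central l x' ->
       `|p x - p x'| <= C * (l%:R ^+ 2 / n%:R) * rho)
    /\ forall t, c * rho <= p (row_of_nat n (fun=> 1%N) *+ m + ballot b n t)].
Proof.
have [C C0 HC] := sqn_law_upper R K T_gt0.
pose c : R := (4 * (16 * K.+1)%:R ^+ K * M)^-1.
have c0 : 0 < c by rewrite invr_gt0 !mulr_gt0 ?exprn_gt0 // ltr0n.
exists (6 * K%:R ^+ 2 * M ^+ 2 * C), c; split => //.
  by rewrite !mulr_ge0 ?sqr_ge0 // ltW.
move=> b b_adj b_rev m n m4 nm.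
(* Thus [4 ^ t.+1 <= m < 4 ^ t.+2]; [4 <= m] makes the logarithm positive, so the predecessor is
   genuine. *)
pose t := (trunc_log 4 m).-1.
have lo : (4 ^ t.+1 <= m)%N.
  by rewrite /t prednK ?trunc_log_gt0 // trunc_logP //; lia.
have hi : (m < 4 ^ t.+2)%N.
  by rewrite /t prednK ?trunc_log_gt0 // trunc_log_ltn.
pose rho : R := (2 ^+ (t * K))^-1.
have pw (j : nat) : 0 < 2 ^+ j :> R by rewrite exprn_gt0.
have rho0 : 0 < rho by rewrite invr_gt0.
exists rho => // p.
have [rev revK Hrev] := ballot_rev b_rev n.
have f4 : 0 < 4 ^+ t :> R by rewrite exprn_gt0.
pose E : R := M ^+ 2 * (C * rho) / (3 * 4 ^+ t).
have E0 : 0 <= E.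
  by rewrite divr_ge0 ?mulr_ge0 ?sqr_ge0 ?exprn_ge0 // ltW.
have HE j i : (m <= j)%N -> osc (law R (ballot b n) j) (unit_row n i) <= E.
  move=> mj; rewrite -(subnKC (leq_trans lo mj)).
  apply: le_trans (osc_law_mono _ _ T_gt0 _ _ _) _.
  rewrite ler_pdivlMr ?mulr_gt0 // mulrC.
  have -> : (4 ^ t.+1 = 4 ^ t + 3 * 4 ^ t)%N by rewrite expnS; lia.
  have := osc_law_unit R T_gt0 b_adj n (4 ^ t) (3 * 4 ^ t) i.
  rewrite natrM natrX => /le_trans; apply; rewrite ler_pM2l ?exprn_gt0 //.
  apply: (HC _ b_adj); apply: leq_trans (leqW _); last first.
    by rewrite nm; apply: leqW; apply: leq_trans (leq_addr m m); exact: lo.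
  by rewrite leq_pexp2l.
have n_gt0 : 0 < n%:R :> R by rewrite nm ltr0n.
split.
  move=> l x x' cx cx'.
  (* [law_smooth] splits the walk into [m.+1] and [m] steps, each part carrying one of the two
     shifts. *)
  have nE : n = (m.+1 + m)%N by rewrite nm.
  have [H1 _] := osc_central E0 (fun i => HE m.+1 i (leqnSn m)) cx cx'.
  have [_ H2] := osc_central E0 (fun i => HE m i (leqnn m)) cx cx'.
  have := law_smooth revK Hrev (i := m.+1) (j := m) (x := x) (x' := x') H1.
  rewrite -nE => /(_ H2) /le_trans; apply.
  have nR : n%:R <= 32 * 4 ^+ t :> R.
    by rewrite -natrX -natrM ler_nat; move: nm hi; clear; rewrite !expnS; lia.
  rewrite /E natrM.
  have -> : (K%:R * l%:R) ^+ 2 * (M ^+ 2 * (C * rho) / (3 * 4 ^+ t)) / 2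
      = (K%:R * l%:R * M) ^+ 2 * C * rho * (6 * 4 ^+ t)^-1.
    by move: (4 ^+ t : R) f4 => u u0; field; rewrite gt_eqF.
  have -> : 6 * K%:R ^+ 2 * M ^+ 2 * C * (l%:R ^+ 2 / n%:R) * rho
      = (K%:R * l%:R * M) ^+ 2 * C * rho * (6 / n%:R) by field; rewrite gt_eqF.
  apply: ler_wpM2l; first by rewrite !mulr_ge0 ?sqr_ge0 // ltW.
  rewrite ler_pdivlMr // mulrC ler_pdivrMr ?mulr_gt0 //.
  by move: (4 ^+ t : R) f4 nR => u; lra.
have -> : p = law R (ballot b n) (m + m).+1 by rewrite /p; congr (law _ _ _).
move=> s.
apply: le_trans (law_near_center R T_gt0 revK Hrev m s).
rewrite ler_pdivlMr //.
(* Of the order of the square root of [m], and large enough for [sqn_law_lower];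
   [L + 2 <= 16 * K.+1 * 2 ^ t] yields the base in [c]. *)
pose L := (8 * 2 ^ t * K.+1)%N.
have HL : (2 * K * m <= L ^ 2)%N.
  apply: (@leq_trans (2 * K.+1 * 4 ^ t.+2)); first by rewrite leq_mul // ?leq_mul // ltnW.
  rewrite /L !expnMn -pow4E !expnS; move: (4 ^ t)%N => u; nia.
apply: le_trans (sqn_law_lower _ T_gt0 b_rev _ HL _); last first.
  by rewrite /L !muln_gt0 expn_gt0.
have A0 : 0 < (16 * K.+1)%:R ^+ K :> R by rewrite exprn_gt0 // ltr0n.
have -> : c * rho * M = (4 * ((16 * K.+1)%:R ^+ K * 2 ^+ (t * K)))^-1.
  rewrite /c /rho; move: ((16 * K.+1)%:R ^+ K : R) (2 ^+ (t * K) : R) A0 (pw (t * K)%N).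
  by move=> A P A0 P0; field; rewrite !gt_eqF.
rewrite lef_pV2 ?posrE ?mulr_gt0 ?exprn_gt0 ?ltr0n //; last by lia.
rewrite ler_pM2l // exprM -exprMn.
apply: lerXn2r; rewrite ?nnegrE ?mulr_ge0 ?exprn_ge0 //.
rewrite -natrX -natrM ler_nat /L.
have : (0 < 2 ^ t)%N by rewrite expn_gt0.
by move: (2 ^ t)%N => u; clear; nia.
Qed.

End NearUniform.

(** * Reflections exchanging the orthants *)

Section Orthants.

Variables (K n : nat).
Implicit Types (x : 'rV['I_n.+1]_K) (y : {ffun 'I_K -> bool}).

Definition orthant x : {ffun 'I_K -> bool} := [ffun i => n < 2 * x 0%R i]%N.

(** [rev_ord] sends [u] to [n - u], so coordinates are reflected in the centre [n / 2]. *)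
Definition flip y y' x : 'rV['I_n.+1]_K :=
  \row_i if y i == y' i then x 0 i else rev_ord (x 0 i).

Lemma flipK y y' : involutive (flip y y').
Proof.
move=> x; apply/rowP => i; rewrite !mxE.
by case: (y i == y' i) => //=; exact: rev_ordK.
Qed.

Lemma central_flip l y y' x : central l (flip y y' x) = central l x.
Proof.
apply: eq_forallb => i; rewrite mxE; case: ifP => // _ /=.
by have := ltn_ord (x 0 i); move: (nat_of_ord _) => u; lia.
Qed.

(** Odd [n] rules out the fixed value [2 * u = n], so each reflected coordinate changes sides. *)
Lemma orthant_flip y y' x : odd n ->
  (orthant (flip y y' x) == y') = (orthant x == y).
Proof.
move=> n_odd.
have H i : (orthant (flip y y' x) i == y' i) = (orthant x i == y i).
  rewrite !ffunE mxE; have [->//|yy'] := eqVneq (y i) (y' i).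
  have -> : (n < 2 * rev_ord (x 0%R i))%N = ~~ (n < 2 * x 0%R i)%N.
    have := ltn_ord (x 0 i); rewrite /=; move: (nat_of_ord _) n_odd => u; lia.
  by case: (y i) (y' i) yy' => [] []; case: (n < _)%N.
by apply/eqP/eqP => /ffunP e; apply/ffunP => i; apply/eqP; move: (H i); rewrite e eqxx.
Qed.

End Orthants.

(** * From the walk law to counts of profiles *)

Section OrthantLaw.

Variables (R : realFieldType) (K : nat) (T : finType) (b : T -> 'I_K -> bool).
Hypothesis T_gt0 : (0 < #|T|)%N.

Definition close_votes (n l : nat) : {set {ffun 'I_n -> T}} :=
  [set w | [forall i, (2 * votes b w i <= n + l) && (n <= 2 * votes b w i + l)]%N].

Definition votes_signs (n : nat) (w : {ffun 'I_n -> T}) : {ffun 'I_K -> bool} :=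
  [ffun i => n < 2 * votes b w i]%N.

Lemma card_votes_event (n : nat) (Q : pred 'rV['I_n.+1]_K) :
  #|[set w : {ffun 'I_n -> T} | Q (row_of_nat n (votes b w))]|%:R
  = #|T|%:R ^+ n * \sum_(x | Q x) law R (ballot b n) n x.
Proof.
have -> : \sum_(x | Q x) law R (ballot b n) n x
    = \sum_x law R (ballot b n) n x * (Q x)%:R.
  by rewrite big_mkcond /=; apply: eq_bigr => x _; case: (Q x); rewrite ?mulr1 ?mulr0.
rewrite law_expectation mulrA mulfV ?mul1r; last by rewrite expf_neq0 // pnatr_eq0 -lt0n.
rewrite -sum1_card natr_sum big_mkcond /=; apply: eq_bigr => w _.
by rewrite inE sum_ballot; case: (Q _).
Qed.

(** At most [n] votes are counted modulo [n.+1], so nothing wraps around. *)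
Lemma row_of_votes n (w : {ffun 'I_n -> T}) i :
  row_of_nat n (votes b w) 0 i = votes b w i :> nat.
Proof. by rewrite mxE /= modn_small // ltnS votes_le. Qed.

Lemma central_votes n l (w : {ffun 'I_n -> T}) :
  central l (row_of_nat n (votes b w)) = (w \in close_votes n l).
Proof. by rewrite inE; apply: eq_forallb => i; rewrite row_of_votes. Qed.

Lemma orthant_votes n (w : {ffun 'I_n -> T}) :
  orthant (row_of_nat n (votes b w)) = votes_signs w.
Proof. by apply/ffunP => i; rewrite !ffunE row_of_votes. Qed.

Lemma central_near_center n m l t : n = (m + m).+1 -> (0 < l)%N ->
  central l (row_of_nat n (fun=> 1%N) *+ m + ballot b n t).
Proof.
move=> nm l0; rewrite row_of_nat1_mulrn -row_of_natD; apply/forallP => i; rewrite mxE /=.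
by move: nm l0; clear; case: (b t i) => nm l0; rewrite modn_small /=; lia.
Qed.

End OrthantLaw.

(** Reflections match the central points of any two orthants, so the masses [P y] and [P z] differ
    by at most [B * D], while the total mass is at least [B * (c / 2 * rho)]. In the quotient [B]
    and [rho] cancel, leaving a multiple of [l ^ 2 / n]. *)
Lemma close_votes_signs_uniform (R : realFieldType) (K : nat) (T : finType) :
  (0 < #|T|)%N -> exists2 alpha : R, 0 < alpha &
  forall b : T -> 'I_K -> bool, adjacent_ballots b -> reversible_ballots b ->
  forall n l, odd n -> (0 < l)%N -> forall y : {ffun 'I_K -> bool},
  `|#|[set w in close_votes b n l | votes_signs b w == y]|%:R / #|close_votes b n l|%:R
    - (2 ^+ K)^-1| <= alpha * (l%:R ^+ 2 / n%:R).
Proof.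
move=> T_gt0; have [C [c [C0 c0 HC]]] := law_near_uniform R K T_gt0.
have Cc0 : 0 <= 2 * C / c by rewrite divr_ge0 ?mulr_ge0 // ltW.
exists (9 + 2 * C / c) => [|b b_adj b_rev n l n_odd l0 y]; first by rewrite ltr_wpDr.
have n0 : 0 < n%:R :> R by rewrite ltr0n; case: n n_odd.
set A := [set w in _ | _]; set E := close_votes b n l.
have l1 : 1 <= l%:R ^+ 2 :> R by rewrite exprn_ege1 // ler1n.
have e0 : 0 <= l%:R ^+ 2 / n%:R :> R by rewrite divr_ge0 ?sqr_ge0.
have triv : 1 <= (9 + 2 * C / c) * (l%:R ^+ 2 / n%:R) ->
    `|#|A|%:R / #|E|%:R - (2 ^+ K)^-1| <= (9 + 2 * C / c) * (l%:R ^+ 2 / n%:R) :> R.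
  apply: le_trans; rewrite ler_distl.
  have AE : #|A|%:R <= #|E|%:R :> R.
    by rewrite ler_nat subset_leq_card //; apply/subsetP => w; rewrite inE => /andP[].
  have r0 : 0 <= #|A|%:R / #|E|%:R :> R by rewrite divr_ge0.
  have r1 : #|A|%:R / #|E|%:R <= 1 :> R.
    have [E0|E0] := posnP #|E|; first by rewrite E0 invr0 mulr0.
    by rewrite ler_pdivrMr ?ltr0n // mul1r.
  have p0 : 0 < (2 ^+ K)^-1 :> R by rewrite invr_gt0 exprn_gt0.
  have p1 : (2 ^+ K)^-1 <= 1 :> R by rewrite invf_le1 ?exprn_gt0 ?exprn_ege1 ?ler1n.
  by lra.
(* The summand 9 of the constant makes the bound trivial here; afterwards [n >= 9] gives
   [m >= 4]. *)
have [n9|n9] := ltnP n 9.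
  apply: triv; rewrite mulrA ler_pdivlMr // mul1r.
  apply: (@le_trans _ _ (9 * 1)); first by rewrite mulr1 ler_nat ltnW.
  by apply: ler_pM => //; rewrite lerDl.
(* Either [2 * C / c] makes the bound trivial, or the variation [D] is at most half of [c * rho] and
   [p] stays above [c / 2 * rho] at all central points. *)
have [big|small] := lerP (c / 2) (C * (l%:R ^+ 2 / n%:R)).
  apply: triv; rewrite mulrDl; apply: ler_wpDl; first by rewrite mulr_ge0.
  have -> : 2 * C / c * (l%:R ^+ 2 / n%:R) = C * (l%:R ^+ 2 / n%:R) / (c / 2).
    by field; rewrite !gt_eqF.
  by rewrite ler_pdivlMr ?divr_gt0 // mul1r.
pose m := n./2.
have nm : n = (m + m).+1 by rewrite -[LHS]odd_double_half n_odd addnn.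
have m4 : (4 <= m)%N by move: n9 nm; clear; lia.
have [rho rho0 /= [Hs Hl]] := HC b b_adj b_rev m n m4 nm.
set p := law R _ n in Hs Hl.
pose D : R := C * (l%:R ^+ 2 / n%:R) * rho.
have [t _] : exists t, t \in T by apply/card_gt0P.
have cx0 : central l (row_of_nat n (fun=> 1%N) *+ m + ballot b n t).
  exact: central_near_center.
move: (row_of_nat n _ *+ m + _) cx0 (Hl t) => x0 cx0 px0.
have plow x : central l x -> c / 2 * rho <= p x.
  move=> cx; have := Hs l x0 x cx0 cx; rewrite -/D.
  have : D <= c / 2 * rho by rewrite ler_wpM2r // ltW.
  by rewrite ler_norml => H /andP[_]; lra.
pose P (z : {ffun 'I_K -> bool}) := \sum_(x | central l x && (orthant x == z)) p x.
pose PE := \sum_(x | central l x) p x.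
pose B := #|[pred x : 'rV['I_n.+1]_K | central l x && (orthant x == y)]|.
have PEE : PE = \sum_z P z.
  by rewrite /PE (partition_big (@orthant K n) predT).
have PE0 : 0 < PE.
  rewrite /PE (bigD1 x0) //= ltr_wpDr //; first by apply: sumr_ge0 => x _; exact: law_ge0.
  by apply: lt_le_trans (plow _ cx0); rewrite !mulr_gt0 // invr_gt0.
have PEB : B%:R * (c / 2 * rho) <= PE.
  rewrite mulr_natl -sumr_const /PE big_mkcond [leRHS]big_mkcond /=.
  apply: ler_sum => x _; rewrite inE; case: (boolP (central l x)) => //= cx.
  by case: ifP => _; [exact: plow | exact: law_ge0].
have PP z : `|P y - P z| <= B%:R * D.
  have -> : P z = \sum_(x | central l x && (orthant x == y)) p (flip y z x).
    rewrite /P (reindex_inj (inv_inj (flipK y z))) /=; apply: eq_bigl => x /=.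
    by rewrite central_flip orthant_flip.
  rewrite /P -sumrB; apply: le_trans (ler_norm_sum _ _ _) _.
  rewrite mulr_natl -sumr_const; apply: ler_sum => x /andP[cx _].
  by apply: Hs; rewrite ?central_flip.
have -> : #|A|%:R / #|E|%:R = P y / PE :> R.
  have -> : A = [set w | (fun x => central l x && (orthant x == y))
      (row_of_nat n (votes b w))].
    by apply/setP => w; rewrite !inE central_votes orthant_votes inE.
  have -> : E = [set w | central l (row_of_nat n (votes b w))].
    by apply/setP => w; rewrite !inE central_votes inE.
  rewrite (card_votes_event R b T_gt0 (fun x => central l x && (orthant x == y))).
  rewrite card_votes_event //.
  rewrite -mulf_div mulfV ?mul1r //.
  by rewrite expf_neq0 // pnatr_eq0 -lt0n.
have p2 : 0 < 2 ^+ K :> R by rewrite exprn_gt0.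
have c2 : (\sum_(z : {ffun 'I_K -> bool}) (1 : R)) = 2 ^+ K.
  by rewrite sumr_const card_ffun card_bool card_ord natrX.
(* [PE] is the sum of the [2 ^ K] masses [P z], each compared with [P y]. *)
have key : `|2 ^+ K * P y - PE| <= 2 ^+ K * (B%:R * D).
  rewrite PEE -c2 !mulr_suml -sumrB; apply: le_trans (ler_norm_sum _ _ _) _.
  by apply: ler_sum => z _; rewrite !mul1r.
have -> : P y / PE - (2 ^+ K)^-1 = (2 ^+ K * P y - PE) / (2 ^+ K * PE).
  by field; rewrite !gt_eqF.
rewrite normf_div (ger0_norm (ltW (mulr_gt0 p2 PE0))) ler_pdivrMr ?mulr_gt0 //.
apply: le_trans key _; rewrite [leRHS]mulrCA ler_pM2l //.
apply: (@le_trans _ _ (2 * C / c * (l%:R ^+ 2 / n%:R) * PE)); last first.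
  by rewrite ler_pM2r // ler_wpM2r // lerDr.
apply: le_trans (ler_wpM2l _ PEB); last by rewrite mulr_ge0.
rewrite /D le_eqVlt; apply/orP; left; apply/eqP.
by field; rewrite !gt_eqF.
Qed.

(** * Rankings and tournaments *)

Section Rankings.

Variables (k : nat) (e : 'I_'C(k, 2) -> 'I_k * 'I_k).
Hypothesis e_pairs : pair_enumeration e.
Local Notation K := 'C(k, 2).
Implicit Types (a c : 'I_k) (i j : 'I_K) (s t : ranking k).

Lemma pair_neq i : (e i).1 != (e i).2. Proof. by have [H _] := e_pairs. Qed.

Lemma pair_index a c : a != c -> exists i, e i = (a, c) \/ e i = (c, a).
Proof.
move=> ac; have [_ /(_ a c ac) [i [Hi _]]] := e_pairs; exists i.
have [n1 e1 e2] : [/\ (e i).1 != (e i).2, (e i).1 \in [set a; c] & (e i).2 \in [set a; c]].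
  by rewrite pair_neq -Hi !inE !eqxx orbT.
move: n1 e1 e2; rewrite !inE; case: (e i) => u v /=.
move=> nuv /orP[] /eqP eu /orP[] /eqP ev; subst u v; rewrite ?eqxx // in nuv *; auto.
Qed.

Lemma pair_index_inj i j : e j = e i \/ e j = ((e i).2, (e i).1) -> j = i.
Proof.
move=> H; have [_ /(_ _ _ (pair_neq i)) [i0 [_ U]]] := e_pairs.
rewrite -(U i) // -(U j) //; case: H => -> //=; exact: setUC.
Qed.

Definition pair_ballot s i : bool := prefers s (e i).1 (e i).2.

Lemma prefersN s a c : a != c -> prefers s c a = ~~ prefers s a c.
Proof.
move=> ac; rewrite /prefers -leqNgt [RHS]leq_eqVlt.
case: eqP => // /ord_inj sca.
by rewrite (perm_inj sca) eqxx in ac.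
Qed.

Lemma pair_ballot_reversible : reversible_ballots pair_ballot.
Proof.
have r_inj : injective (@rev_ord k) by exact: rev_ord_inj.
exists (fun s => s * perm r_inj)%g => [s|s i].
  by apply/permP => a; rewrite !permM !permE rev_ordK.
rewrite /pair_ballot -prefersN ?pair_neq // /prefers !permM !permE /=.
have := ltn_ord (s (e i).1); have := ltn_ord (s (e i).2).
by move: (nat_of_ord _) (nat_of_ord _) => u v; lia.
Qed.

Lemma ranking_top2 a c : (2 <= k)%N -> a != c -> exists s, s a = 0%N :> nat /\ s c = 1%N :> nat.
Proof.
move=> k_ge2 ac.
pose o0 : 'I_k := Ordinal (ltnW k_ge2); pose o1 : 'I_k := Ordinal k_ge2.
have n01 : o0 != o1 by [].
pose s1 := tperm a o0; pose s2 := tperm (s1 c) o1.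
exists (s1 * s2)%g; rewrite !permM.
have -> : s2 (s1 c) = o1 by exact: tpermL.
have s1a : s1 a = o0 by exact: tpermL.
rewrite s1a /s2 tpermD // -s1a.
by apply: contraNneq ac => H; rewrite (perm_inj H).
Qed.

(** Put the pair [i] in the top two positions and exchange its members: all other alternatives stay
    below both, so no other comparison changes. *)
Lemma pair_ballot_adjacent : (2 <= k)%N -> adjacent_ballots pair_ballot.
Proof.
move=> k_ge2 i; have [s [sa sc]] := ranking_top2 k_ge2 (pair_neq i).
exists (tperm (e i).1 (e i).2 * s)%g, s => j; rewrite /pair_ballot /prefers !permM.
have [->|ji] := eqVneq j i; first by rewrite tpermL tpermR sa sc.
rewrite addn0; congr nat_of_bool.
have s_ge2 x : x != (e i).1 -> x != (e i).2 -> (1 < s x)%N.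
  move=> xa xc; have : s x != 0%N :> nat.
    by rewrite -sa; apply: contraNneq xa => /ord_inj H; rewrite (perm_inj H).
  have : s x != 1%N :> nat.
    by rewrite -sc; apply: contraNneq xc => /ord_inj H; rewrite (perm_inj H).
  by move: (nat_of_ord _) => u; lia.
have := pair_neq j; have H := @pair_index_inj i j.
move: H s_ge2 sa sc; case: (e j) => x y; case: (e i) => a c /= H s_ge2 sa sc xy.
have {}H : ~ ((x, y) = (a, c) \/ (x, y) = (c, a)) by move=> /H /eqP; rewrite (negPf ji).
case: tpermP => [xa|xc|/eqP xa /eqP xc]; case: tpermP => [ya|yc|/eqP ya /eqP yc]; subst;
  rewrite ?sa ?sc ?eqxx // in xy *; try by [case: H; auto].
- by have := s_ge2 _ ya yc; move: (nat_of_ord _) => u; lia.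
- by have := s_ge2 _ ya yc; move: (nat_of_ord _) => u; lia.
- by have := s_ge2 _ xa xc; move: (nat_of_ord _) => u; lia.
- by have := s_ge2 _ xa xc; move: (nat_of_ord _) => u; lia.
Qed.

Lemma marginE n (w : profile n k) a c : a != c ->
  margin w a c = 2 * (\sum_v prefers (w v) a c)%N%:Z - n%:Z.
Proof.
move=> ac; rewrite /margin.
have cE (x y : 'I_k) : #|[set v | prefers (w v) x y]| = (\sum_v prefers (w v) x y)%N.
  by rewrite -sum1_card big_mkcond /=; apply: eq_bigr => v _; rewrite inE; case: prefers.
have : (#|[set v | prefers (w v) a c]| + #|[set v | prefers (w v) c a]| = n)%N.
  rewrite !cE -big_split /= -[RHS]card_ord -sum1_card; apply: eq_bigr => v _.
  by rewrite (prefersN (w v) ac); case: prefers.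
by rewrite -cE; lia.
Qed.

Lemma margin_pair n (w : profile n k) i :
  margin w (e i).1 (e i).2 = 2 * (votes pair_ballot w i)%:Z - n%:Z.
Proof. by rewrite marginE ?pair_neq. Qed.

(** Margins are integers, so [d] can be replaced by its integer part; the order inside a pair only
    affects the sign of the margin. *)
Lemma close_electionE (R : archiRealFieldType) n (d : R) : 0 <= d ->
  close_election n k d = close_votes pair_ballot n (Num.truncn d).
Proof.
move=> d0; apply/setP => w; rewrite !inE.
have dE (z : int) : (`|z|%:~R <= d) = (`|z| <= Num.truncn d)%N.
  by rewrite truncn_ge_nat // -abszE.
have dl i : (`|margin w (e i).1 (e i).2|%:~R <= d)
  = (2 * votes pair_ballot w i <= n + Num.truncn d)%N
    && (n <= 2 * votes pair_ballot w i + Num.truncn d)%N.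
  by rewrite dE margin_pair; move: (Num.truncn d) (votes _ _ _) => u v; lia.
apply/forallP/forallP => [H i|H a].
  by rewrite -dl; have /forallP/(_ (e i).2)/implyP := H (e i).1; apply; exact: pair_neq.
apply/forallP => c; apply/implyP => ac.
have [i [ei|ei]] := pair_index ac; have := H i; rewrite -dl ei //=.
by rewrite /margin distrC.
Qed.

Definition sign_vector (z : {ffun 'I_K -> bool}) : {ffun 'I_K -> int} :=
  [ffun i => if z i then 1 else -1].

Lemma outcomeE n (w : profile n k) : odd n ->
  outcome e w = sign_vector (votes_signs pair_ballot w).
Proof.
move=> n_odd; apply/ffunP => i; rewrite !ffunE margin_pair.
case: ltnP => H; [apply: gtr0_sg | apply: ltr0_sg]; last first.
  (* Parity excludes a zero margin. *)
  have : (2 * votes pair_ballot w i != n)%N by apply: contraTneq n_odd => <-; rewrite oddM.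
  by move: (votes _ _ _) H => u; lia.
by move: (votes _ _ _) H => u; lia.
Qed.

Lemma PrE (R : realFieldType) n (A : {set profile n k}) :
  Pr R A = #|A|%:R / #|{: ranking k}|%:R ^+ n.
Proof. by rewrite /Pr sumr_const prodr_const card_ord exprVn mulr_natl. Qed.

Lemma condPrE (R : realFieldType) n (A B : {set profile n k}) :
  condPr R A B = #|A :&: B|%:R / #|B|%:R.
Proof.
rewrite /condPr !PrE -mulf_div divff ?mulr1 // invr_eq0 expf_neq0 // pnatr_eq0 -lt0n.
by apply/card_gt0P; exists 1%g.
Qed.

Lemma beats_pair z i : (beats e (sign_vector z) (e i).1 (e i).2 = z i)
  * (beats e (sign_vector z) (e i).2 (e i).1 = ~~ z i).
Proof.
have nP := pair_neq i.
have dich j : (e j == ((e i).1, (e i).2)) || (e j == ((e i).2, (e i).1)) -> j = i.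
  by case/orP=> /eqP ej; apply: pair_index_inj; rewrite ej -?surjective_pairing; auto.
have ne : (e i == ((e i).2, (e i).1)) = false.
  by apply: contraNF nP; case: (e i) => x y /= /eqP[->].
split; apply/existsP/idP => [[j]|zi].
- move=> H; have ji : j = i by apply: dich; case/orP: H => /andP[-> _]; rewrite ?orbT.
  by move: H; rewrite ji ne orbF ffunE => /andP[_]; case: (z i).
- by exists i; rewrite -surjective_pairing eqxx ffunE zi.
- move=> H; have ji : j = i by apply: dich; case/orP: H => /andP[-> _]; rewrite ?orbT.
  by move: H; rewrite ji ne /= ffunE => /andP[_]; case: (z i).
- by exists i; rewrite -surjective_pairing eqxx ffunE (negPf zi) orbT.
Qed.

Lemma beats_irr y a : beats e y a a = false.
Proof.
apply/existsP => -[i /orP[] /andP[/eqP ei]]; by have := pair_neq i; rewrite ei eqxx.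
Qed.

Lemma beatsN z a c : a != c ->
  beats e (sign_vector z) c a = ~~ beats e (sign_vector z) a c.
Proof.
move=> ac; have [i [ei|ei]] := pair_index ac; have := beats_pair z i; rewrite ei /= => -[-> ->] //.
by rewrite negbK.
Qed.

Definition ballot_vector s : {ffun 'I_K -> bool} := [ffun i => pair_ballot s i].

Lemma beats_ballot_vector s a c :
  beats e (sign_vector (ballot_vector s)) a c = prefers s a c.
Proof.
have [->|ac] := eqVneq a c; first by rewrite beats_irr /prefers ltnn.
have [i [ei|ei]] := pair_index ac; have := beats_pair (ballot_vector s) i;
  rewrite ffunE /pair_ballot ei /= => -[H1 H2] //.
by rewrite H2 -prefersN // eq_sym.
Qed.

(** Recovers a ranking from its preferences, which makes [ballot_vector] injective. *)
Lemma ranking_count s a : s a = #|[set c | prefers s c a]| :> nat.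
Proof.
have -> : [set c | prefers s c a] = s @^-1: [set x : 'I_k | (x < s a)%N].
  by apply/setP => c; rewrite !inE.
rewrite card_preimset; last exact: perm_inj.
rewrite -sum1_card; under eq_bigl do rewrite inE.
by rewrite -(big_ord_widen _ (fun=> 1%N) (ltnW (ltn_ord (s a)))) sum1_card card_ord.
Qed.

(** [ballot_vector] is a bijection from rankings onto transitive sign patterns. *)
Lemma card_transitive :
  #|[set z : {ffun 'I_K -> bool} | is_transitive e (sign_vector z)]| = k`!.
Proof.
have inj : injective ballot_vector.
  move=> s t st; apply/permP => a; apply: val_inj; rewrite /= !ranking_count.
  by congr #|pred_of_set _|; apply/setP => c; rewrite !inE -!beats_ballot_vector st.
rewrite -[RHS](card_Sn k) -(card_imset _ inj); congr #|pred_of_set _|.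
apply/setP => z; rewrite inE; apply/idP/imsetP => [|[s _ ->]]; last first.
  apply/and3P; split.
  - by apply/forallP => a; rewrite beats_irr.
  - do 3![apply/forallP => ?]; apply/implyP; rewrite !beats_ballot_vector => /andP[].
    exact: ltn_trans.
  - do 2![apply/forallP => ?]; apply/implyP => ac; rewrite !beats_ballot_vector.
    by rewrite (prefersN _ ac) orbN.
case/and3P => _ /'forall_'forall_forallP trz _.
set r := beats e (sign_vector z) in trz.
have rtr a c x : r a c -> r c x -> r a x.
  by move=> ac cx; have /implyP := trz a c x; apply; rewrite ac.
(* The number of alternatives beating [a] will be its position. By transitivity it strictly
   increases along [r], hence is injective since [r] compares any two alternatives. *)
pose D a := [set c | r c a].
have Dlt a : (#|D a| < k)%N.
  have : (#|D a| < #|[set: 'I_k]|)%N.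
    apply: proper_card; rewrite properE subsetT /=.
    by apply/subsetPn; exists a; rewrite inE // /r beats_irr.
  by rewrite cardsT card_ord.
have Dmono a c : r a c -> (#|D a| < #|D c|)%N.
  move=> ac; apply: proper_card; rewrite properE; apply/andP; split.
    by apply/subsetP => x; rewrite !inE => xa; exact: rtr ac.
  by apply/subsetPn; exists a; rewrite inE // /r beats_irr.
have D_inj : injective (fun a => Ordinal (Dlt a)).
  move=> a c /(congr1 val) /= Dac; apply/eqP; apply: contraT => ac.
  have [rac|rca] := boolP (r a c).
    by have := Dmono _ _ rac; rewrite Dac ltnn.
  have {}rca : r c a by rewrite /r beatsN.
  by have := Dmono _ _ rca; rewrite Dac ltnn.
exists (perm D_inj) => //; apply/ffunP => i; rewrite ffunE /pair_ballot /prefers !permE /=.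
have [H1 H2] := beats_pair z i; case: (z i) H1 H2 => H1 H2.
  by rewrite Dmono.
by apply/esym/negbTE; rewrite -leqNgt ltnW // Dmono.
Qed.

(** Sending a pair to its member other than [a] is a bijection onto the remaining alternatives. *)
Lemma card_pairs_with a :
  #|[set i | ((e i).1 == a) || ((e i).2 == a)]| = k.-1.
Proof.
pose other i := if (e i).1 == a then (e i).2 else (e i).1.
rewrite -(card_in_imset (f := other)).
  have -> : other @: [set i | ((e i).1 == a) || ((e i).2 == a)] = [set~ a].
    apply/setP => c; rewrite !inE; apply/imsetP/idP => [[i]|ca].
      rewrite inE /other; have := pair_neq i.
      by case: (e i) => x y /= xy; case: eqP => [<- _ ->|/eqP xa _ ->] //; rewrite eq_sym.
    have [i ei] := pair_index ca; exists i; rewrite ?inE /other.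
      by case: ei => -> /=; rewrite eqxx ?orbT.
    by case: ei => -> /=; rewrite ?eqxx ?(negPf ca).
  by rewrite cardsC1 card_ord.
move=> i j; rewrite !inE /other => Hi Hj Hij; apply: pair_index_inj.
have := pair_neq i; have := pair_neq j; move: Hi Hj Hij.
move: (e i) (e j) => [x y] [x' y'] /=.
have [->|xa] := eqVneq x a; have [->|xa'] := eqVneq x' a => /=.
- by move=> _ _ ->; auto.
- by move=> _ /eqP -> ->; auto.
- by move=> /eqP -> _ ->; auto.
- by move=> /eqP -> /eqP -> ->; auto.
Qed.

(** The [k.-1] pairs containing [a] are forced and the others free; the product form avoids
    subtracting exponents. *)
Lemma card_wins_all a :
  (#|[set z : {ffun 'I_K -> bool} |
      [forall c, (c != a) ==> beats e (sign_vector z) a c]]| * 2 ^ k.-1 = 2 ^ K)%N.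
Proof.
pose I := [set i | ((e i).1 == a) || ((e i).2 == a)].
pose F i : pred bool := if i \in I then pred1 ((e i).1 == a) else predT.
have -> : #|[set z : {ffun 'I_K -> bool} |
    [forall c, (c != a) ==> beats e (sign_vector z) a c]]| = #|family F|.
  apply: eq_card => z; rewrite inE; apply/forallP/familyP => [H i|H c].
    rewrite /F; case: ifP => // iI; rewrite inE; move: iI; rewrite inE.
    have := beats_pair z i; have := pair_neq i; have := H (e i).1; have := H (e i).2.
    case: (e i) => x y /= Hy Hx xy [H1 H2]; case: eqP => [xa _|/eqP xa /= /eqP ya].
      by subst x; rewrite -H1 (implyP Hy) // eq_sym.
    by subst y; apply/eqP/negbTE; rewrite -H2 (implyP Hx).
  apply/implyP => ca; have [i ei] := pair_index ca.
  have := H i; rewrite /F inE; have := beats_pair z i.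
  by case: ei => -> /=; rewrite eqxx ?orbT ?(negPf ca) /= inE => -[H1 H2] /eqP zi;
    rewrite ?H1 ?H2 zi.
rewrite card_family foldrE big_map big_enum /=.
have -> : (\prod_(i in 'I_K) #|F i| = \prod_i #|F i|)%N by exact: eq_bigl.
rewrite -{1}(card_pairs_with a) -/I -prod_nat_const [X in (_ * X)%N]big_mkcond /= -big_split /=.
rewrite (eq_bigr (fun=> 2)) ?prod_nat_const ?card_ord // => i _.
by rewrite /F; case: ifP => _; rewrite ?card1 // card_bool.
Qed.

(** Two winners would have to beat each other, so the sets [W a] are disjoint and their sizes add
    up. *)
Lemma card_condorcet (R : realFieldType) :
  #|[set z : {ffun 'I_K -> bool} | has_condorcet_winner e (sign_vector z)]|%:R / 2 ^+ K
  = k%:R / 2 ^+ k.-1 :> R.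
Proof.
pose W a := [set z : {ffun 'I_K -> bool} |
      [forall c, (c != a) ==> beats e (sign_vector z) a c]].
have -> : #|[set z : {ffun 'I_K -> bool} | has_condorcet_winner e (sign_vector z)]|
    = (\sum_a #|W a|)%N.
  rewrite -[LHS]sum1_card.
  under [RHS]eq_bigr do rewrite -sum1_card big_mkcond.
  rewrite /= [RHS]exchange_big /= big_mkcond /=.
  apply: eq_bigr => z _; rewrite inE; case: ifP => [/existsP[a Ha]|nz].
    rewrite (bigD1 a) //= inE Ha big1 // => c ca; rewrite inE; case: ifP => // /forallP Hc.
    have /implyP/(_ ca) rac := forallP Ha c.
    have := Hc a; rewrite eq_sym ca /= => rca.
    by rewrite (beatsN z) ?rac // eq_sym in rca.
  rewrite big1 // => a _; rewrite inE; case: ifP => // Ha.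
  by case/negP: (negbT nz); apply/existsP; exists a.
have p2 (m : nat) : 2 ^+ m != 0 :> R by rewrite expf_neq0 // pnatr_eq0.
apply/eqP; rewrite eqr_div // -!natrX -!natrM eqr_nat; apply/eqP.
rewrite big_distrl /= (eq_bigr _ (fun a _ => card_wins_all a)).
by rewrite sum_nat_const card_ord.
Qed.

End Rankings.

(** Sums [close_votes_signs_uniform] over the sign patterns satisfying [Q]; one [alpha], chosen
    before [e], [n], [d] and [Q], serves all three claims. *)
Lemma condPr_outcome_uniform (R : archiRealFieldType) (k : nat) : (2 <= k)%N ->
  exists2 alpha : R, 0 < alpha &
  forall (e : 'I_'C(k, 2) -> 'I_k * 'I_k), pair_enumeration e ->
  forall n, odd n -> forall d : R, 1 <= d ->
  forall Q : pred {ffun 'I_'C(k, 2) -> int},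
  `|condPr R [set w | Q (outcome e w)] (close_election n k d)
    - #|[set z | Q (sign_vector z)]|%:R / 2 ^+ 'C(k, 2)|
  <= #|[set z | Q (sign_vector z)]|%:R * alpha * (d ^+ 2 / n%:R).
Proof.
move=> k2.
have T0 : (0 < #|{: ranking k}|)%N by apply/card_gt0P; exists 1%g.
have [alpha a0 H] := close_votes_signs_uniform R 'C(k, 2) T0.
exists alpha => // e eP n n_odd d d1 Q; set N : R := #|_|%:R.
have d0 : 0 <= d by exact: le_trans d1.
have l0 : (0 < Num.truncn d)%N by rewrite truncn_ge_nat.
have {}H z := H _ (pair_ballot_adjacent eP k2) (pair_ballot_reversible eP) n _ n_odd l0 z.
rewrite condPrE (close_electionE eP) //; set E := close_votes _ _ _ in H *.
set b := pair_ballot e in E H *.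
have -> : #|[set w | Q (outcome e w)] :&: E|%:R
    = \sum_(z | Q (sign_vector z)) #|[set w in E | votes_signs b w == z]|%:R :> R.
  rewrite -sum1_card natr_sum (partition_big (@votes_signs _ _ b n) (fun z => Q (sign_vector z))) /=.
    apply: eq_bigr => z Qz; rewrite -sum1_card natr_sum; apply: eq_bigl => w.
    rewrite in_setI in_set [RHS]in_set (outcomeE eP) // -/b.
    by case: eqP => [->|_]; rewrite ?andbF // Qz !andbT.
  by move=> w; rewrite in_setI in_set (outcomeE eP) // => /andP[].
have NE (x : R) : N * x = \sum_(z | Q (sign_vector z)) x.
  by rewrite sumr_const mulr_natl; congr (_ *+ _); apply: eq_card => z; rewrite inE.
rewrite [N / _]NE mulr_suml -sumrB -mulrA NE; apply: le_trans (ler_norm_sum _ _ _) _.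
apply: ler_sum => z _; apply: le_trans (H z) _; rewrite ler_pM2l //.
by rewrite ler_wpM2r ?invr_ge0 // lerXn2r ?nnegrE // truncn_le.
Qed.

(* The three claims over the real numbers *)
From mathcomp Require Import all_classical all_reals all_analysis.
Import Order.TTheory GRing.Theory Num.Theory.
Import numFieldNormedType.Exports.
Local Open Scope ring_scope.

Theorem theorem1p4 (R : realType) (k : nat) (hk : (2 <= k)%N) :
  exists (alpha beta gamma : R) (o1 o2 o3 : nat -> R),
    [/\ 0 < alpha, 0 < beta & 0 < gamma] /\
    [/\ (o1 n @[n --> \oo] --> (0 : R))%classic,
        (o2 n @[n --> \oo] --> (0 : R))%classic
      & (o3 n @[n --> \oo] --> (0 : R))%classic] /\
    forall (e : 'I_'C(k, 2) -> 'I_k * 'I_k), pair_enumeration e ->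
    forall (n : nat), odd n ->
    forall (d : R), 1 <= d ->
    [/\ forall y : {ffun 'I_'C(k, 2) -> int}, is_sign_vector y ->
          `|condPr R [set w : profile n k | outcome e w == y]%SET
                     (close_election n k d)
            - 1 / 2 ^+ 'C(k, 2)|
          <= alpha * (d ^+ 2 / n%:R) + o1 n,
        `|condPr R [set w : profile n k | is_transitive e (outcome e w)]%SET
                   (close_election n k d)
          - k`!%:R / 2 ^+ 'C(k, 2)|
        <= beta * (d ^+ 2 / n%:R) + o2 n
      & `|condPr R [set w : profile n k |
                      has_condorcet_winner e (outcome e w)]%SET
                   (close_election n k d)
          - k%:R / 2 ^+ (k - 1)|
        <= gamma * (d ^+ 2 / n%:R) + o3 n].
Proof.
have [alpha a0 H] := @condPr_outcome_uniform R k hk.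
have Ka0 : 0 < 2 ^+ 'C(k, 2) * alpha by rewrite mulr_gt0 ?exprn_gt0.
have cst0 : ((fun _ : nat => 0 : R) n @[n --> \oo] --> (0 : R))%classic by exact: cvg_cst.
(* An event contains at most [2 ^ 'C(k, 2)] sign patterns, whence the second and third constants;
   the error terms are zero. *)
exists alpha, (2 ^+ 'C(k, 2) * alpha), (2 ^+ 'C(k, 2) * alpha),
  (fun=> 0), (fun=> 0), (fun=> 0).
split; first by split.
split; first by split.
move=> e eP n n_odd d d1.
have {}H := H e eP n n_odd d d1.
have dn0 : 0 <= d ^+ 2 / n%:R by rewrite divr_ge0 ?sqr_ge0.
have cardK (S : {set {ffun 'I_'C(k, 2) -> bool}}) :
    #|S|%:R * alpha * (d ^+ 2 / n%:R) <= 2 ^+ 'C(k, 2) * alpha * (d ^+ 2 / n%:R).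
  rewrite ler_wpM2r // ler_pM2r // -natrX ler_nat.
  by apply: leq_trans (max_card _) _; rewrite card_ffun card_bool card_ord.
split; rewrite addr0.
- move=> y ysign.
  (* The Boolean form of [y], so that the event consists of a single sign pattern. *)
  pose z : {ffun 'I_'C(k, 2) -> bool} := [ffun i => y i == 1].
  have yz : sign_vector z = y.
    by apply/ffunP => i; rewrite !ffunE; case: (ysign i) => ->.
  have sign_inj z' : sign_vector z' = sign_vector z -> z' = z.
    move=> /ffunP E; apply/ffunP => i; have := E i.
    by rewrite [LHS]ffunE [RHS]ffunE; case: (z' i) (z i) => [] [].
  have := H (pred1 y).
  have -> : [set z' | pred1 y (sign_vector z')]%SET = [set z]%SET.
    by apply/setP => z'; rewrite !inE -yz; apply/eqP/eqP => [/sign_inj|->].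
  by rewrite cards1 (mul1r alpha).
- have := H (fun y => is_transitive e y).
  by rewrite {1}(card_transitive eP) => /le_trans; apply; exact: cardK.
- have := H (fun y => has_condorcet_winner e y).
  by rewrite (card_condorcet eP) subn1 => /le_trans; apply; exact: cardK.
Qed.
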